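(* Let $n\ge 2$, let $\lambda,\mu,\nu\in\mathbb{R}$, and let $$\mathbb{F}^n_\lambda\otimes\mathbb{F}^n_\mu\to\mathbb{F}^n_\nu,\qquad F\alpha_n^\lambda\otimes G\alpha_n^\mu\mapsto \mathfrak{T}^n_{\lambda,\mu,\nu}(F,G)\,\alpha_n^\nu$$ be a nontrivial (i.e. nonzero) $\mathcal{K}(n)$-invariant binary differential operator. Then $\nu=\lambda+\mu$ or $\nu=\lambda+\mu+1$. Moreover: (a) If $\nu=\lambda+\mu$, then $\mathfrak{T}^n_{\lambda,\mu,\nu}=\alpha\,\mathfrak{a}$ for some $\alpha\in\mathbb{R}$. (b) If $\nu=\lambda+\mu+1$, then: if $n>2$, or if $n=2$ and $\lambda\mu\nu\neq0$, we have $\mathfrak{T}^n_{\lambda,\mu,\nu}=\alpha\,\mathfrak{b}$ for some $\alpha\in\mathbb{R}$; if $n=2$ and $\lambda\mu\nu=0$, then $\mathfrak{T}^n_{\lambda,\mu,\nu}$ has the form $\alpha\mathfrak{b}+\beta\mathfrak{c}$, $\alpha\mathfrak{b}+\beta\mathfrak{d}$, or $\alpha\mathfrak{b}+\beta\mathfrak{e}$, with $\alpha,\beta\in\mathbb{R}$, in accordance with $\lambda=0$, $\mu=0$, or $\nu=0$ respectively. Here $\mathfrak{a},\mathfrak{b}$ (and, for $n=2$, $\mathfrak{c},\mathfrak{d},\mathfrak{e}$) are the bilinear operators given for parity-homogeneous $F$ and arbitrary $G$ by $$\mathfrak{a}(F,G)=FG,$$ $$\mathfrak{b}(F,G)=\mu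 F'G-\lambda FG'-\tfrac12(-1)^{|F|}\sum_{i=1}^n\eta_i(F)\eta_i(G),$$ $$\mathfrak{c}(F,G)=(-1)^{|F|}\big(\eta_1(F)\eta_2(G)-\eta_2(F)\eta_1(G)\big)+2\mu\,\eta_2\eta_1(F)\,G,$$ $$\mathfrak{d}(F,G)=(-1)^{|F|}\big(\eta_1(F)\eta_2(G)-\eta_2(F)\eta_1(G)\big)+2\lambda\,F\,\eta_2\eta_1(G),$$ $$\mathfrak{e}(F,G)=(-1)^{|F|}(\lambda+\tfrac12)\big(\eta_1(F)\eta_2(G)-\eta_2(F)\eta_1(G)\big)+\lambda F\,\eta_1\eta_2(G)+(\lambda+1)\,\eta_1\eta_2(F)\,G.$$
   Context: $\mathbb{R}[x,\theta]=\mathbb{R}[x,\theta_1,\dots,\theta_n]$ is the supercommutative superalgebra of polynomials in one even variable $x$ and $n$ anticommuting odd variables $\theta_i$; $|F|$ denotes parity, $F'=\partial_xF$, $\partial_x=\frac{\partial}{\partial x}$, $\partial_i=\frac{\partial}{\partial\theta_i}$. Put $\eta_i=\partial_i-\theta_i\partial_x$ and $\alpha_n=dx+\sum_{i=1}^n\theta_i\,d\theta_i$ (the contact form). $\mathcal{K}(n)$ is the Lie superalgebra of polynomial contact vector fields on $\mathbb{R}^{1|n}$; it is spanned by $$X_F=F\partial_x-\tfrac12(-1)^{|F|}\sum_{i=1}^n\eta_i(F)\eta_i,\qquad F\in\mathbb{R}[x,\theta],$$ with bracket $[X_F,X_G]=X_{\{F,G\}}$, $\{F,G\}=FG'-F'G-\frac12(-1)^{|F|}\sum_i\eta_i(F)\eta_i(G)$.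 For $\lambda\in\mathbb{R}$, $\mathbb{F}^n_\lambda=\{F\alpha_n^\lambda: F\in\mathbb{R}[x,\theta]\}$ is the $\mathcal{K}(n)$-module (weighted densities of weight $\lambda$) that equals $\mathbb{R}[x,\theta]$ as a superspace, with action $\mathbb{L}^\lambda_{X_F}=X_F+\lambda F'$. A binary differential operator $A:\mathbb{F}^n_\lambda\otimes\mathbb{F}^n_\mu\to\mathbb{F}^n_\nu$ is a bilinear map $(F,G)\mapsto A(F,G)$ that is a finite linear combination, with coefficients in $\mathbb{R}[x,\theta]$ (and signs depending on $|F|$ allowed), of products of derivatives (in $x,\theta_1,\dots,\theta_n$) of $F$ and of $G$. The algebra $\mathcal{K}(n)$ acts on such operators by $$(X_H\cdot A)(F,G)=\mathbb{L}^\nu_{X_H}A(F,G)-(-1)^{|A||H|}\big(A(\mathbb{L}^\lambda_{X_H}F,G)+(-1)^{|F||H|}A(F,\mathbb{L}^\mu_{X_H}G)\big),$$ and $A$ is $\mathcal{K}(n)$-invariant if $X_H\cdot A=0$ for all $H$. *)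

(* Defs.v *)
From HB Require Import structures.
From mathcomp Require Import all_boot all_order all_algebra ring.

Set Implicit Arguments.
Unset Strict Implicit.
Unset Printing Implicit Defensive.

Import GRing.Theory.
Local Open Scope ring_scope.

(* The superalgebra R[x, theta_0, ..., theta_(n-1)]: the value of F at a set  *)
(* S = {i_1 < ... < i_k} is the coefficient, a polynomial in x, of the        *)
(* monomial theta_(i_1) ... theta_(i_k).                                      *)
Definition superpoly (R : comNzRingType) (n : nat) : Type :=
  {ffun {set 'I_n} -> {poly R}}.

HB.instance Definition _ (R : comNzRingType) (n : nat) :=
  GRing.Lmodule.on (superpoly R n).

Section Superalgebra.
Variables (R : comNzRingType) (n : nat).
Local Notation V := (superpoly R n).
Implicit Types (F G H : V) (S T U W : {set 'I_n}).

Definition scoef F S : {poly R} := (F : {ffun {set 'I_n} -> {poly R}}) S.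

Definition spoly (f : {set 'I_n} -> {poly R}) : V :=
  ([ffun S => f S] : {ffun {set 'I_n} -> {poly R}}).

Lemma scoefE f S : scoef (spoly f) S = f S.
Proof. by rewrite /scoef /spoly ffunE. Qed.

Lemma superpolyP F G : (forall S, scoef F S = scoef G S) <-> F = G.
Proof. by split=> [eqFG | -> //]; apply/ffunP. Qed.

Lemma scoefD F G S : scoef (F + G) S = scoef F S + scoef G S.
Proof. by rewrite /scoef ffunE. Qed.

Lemma scoefZ (a : R) F S : scoef (a *: F) S = a *: scoef F S.
Proof. by rewrite /scoef ffunE. Qed.

Lemma scoef0 S : scoef 0 S = 0.
Proof. by rewrite /scoef ffunE. Qed.

Lemma scoefN F S : scoef (- F) S = - scoef F S.
Proof. by rewrite /scoef ffunE. Qed.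

(* For disjoint S and T, the product of the monomials of S and T is           *)
(* (-1) ^ (ninv S T) times the monomial of S :|: T.                           *)
Definition ninv S T : nat := (\sum_(i in S) \sum_(j in T) (j < i))%N.

Lemma ninv0l T : ninv set0 T = 0%N.
Proof. by rewrite /ninv big_set0. Qed.

Lemma ninv0r S : ninv S set0 = 0%N.
Proof. by rewrite /ninv big1 // => i _; rewrite big_set0. Qed.

Lemma sum_setU_disjoint S T (f : 'I_n -> nat) : [disjoint S & T] ->
  (\sum_(i in S :|: T) f i = \sum_(i in S) f i + \sum_(i in T) f i)%N.
Proof. by move=> dST; rewrite -bigU //; apply: eq_bigl => i; rewrite !inE. Qed.

Lemma ninvUl S S' T :
  [disjoint S & S'] -> ninv (S :|: S') T = (ninv S T + ninv S' T)%N.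
Proof. exact: sum_setU_disjoint. Qed.

Lemma ninvUr S T T' :
  [disjoint T & T'] -> ninv S (T :|: T') = (ninv S T + ninv S T')%N.
Proof.
move=> dTT'; rewrite /ninv -big_split; apply: eq_bigr => i _.
exact: sum_setU_disjoint.
Qed.

Definition superone : V := spoly (fun S => (S == set0)%:R).

Definition supermul F G : V := spoly (fun U =>
  \sum_(S : {set 'I_n} | S \subset U)
     (-1) ^+ ninv S (U :\: S) * (scoef F S * scoef G (U :\: S))).

Fact supermulA : associative supermul.
Proof.
move=> F G H; apply/superpolyP => U; rewrite !scoefE.
under eq_bigr do rewrite scoefE !mulr_sumr.
under [RHS]eq_bigr do rewrite scoefE mulr_suml mulr_sumr.
rewrite [RHS](exchange_big_dep (fun S => S \subset U)) /=; last first.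
  by move=> W S sWU sSW; apply: subset_trans sWU.
apply: eq_bigr => S sSU.
rewrite [RHS](reindex_onto (fun T => S :|: T) (fun W => W :\: S)) /=; last first.
  by move=> W /andP[_ sSW]; rewrite setDE setUIr setUCr setIT; apply/setUidPr.
apply: eq_big => [T | T sTU].
  rewrite subsetUl subUset sSU /= andbT setDUl setDv set0U subsetD.
  by congr (_ && _); apply/idP/eqP => [/setDidPl | /setDidPl].
have dST : [disjoint S & T] by move: sTU; rewrite subsetD disjoint_sym => /andP[].
have dTS : T :\: S = T by apply/setDidPl; rewrite disjoint_sym.
rewrite setDUl setDv set0U dTS -setDDl.
set W := U :\: S :\: T.
have -> : U :\: S = T :|: W.
  by rewrite /W -{1}(setID (U :\: S) T) (setIidPr sTU).
have dTW : [disjoint T & W] by rewrite disjoint_sym disjoints_subset subsetDr.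
rewrite ninvUl // ninvUr // !exprD.
move: (_ ^+ ninv S T) (_ ^+ ninv S W) (_ ^+ ninv T W) => a b c; ring.
Qed.
Fact supermul1l : left_id superone supermul.
Proof.
move=> F; apply/superpolyP => U; rewrite scoefE (bigD1 set0) ?sub0set //=.
rewrite scoefE eqxx setD0 ninv0l expr0 !mul1r big1 ?addr0 // => S /andP[_ nzS].
by rewrite scoefE (negPf nzS) mul0r mulr0.
Qed.

Fact supermul1r : right_id superone supermul.
Proof.
move=> F; apply/superpolyP => U; rewrite scoefE (bigD1 U) //=.
rewrite scoefE setDv eqxx ninv0r expr0 mul1r mulr1 big1 ?addr0 //.
move=> S /andP[sSU neSU]; rewrite scoefE setD_eq0.
have -> : (U \subset S) = false.
  by apply: contraNF neSU => sUS; rewrite eqEsubset sSU.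
by rewrite !mulr0.
Qed.

Fact supermulDl : left_distributive supermul +%R.
Proof.
move=> F G H; apply/superpolyP => U; rewrite scoefD !scoefE -big_split /=.
by apply: eq_bigr => S _; rewrite scoefD mulrDl mulrDr.
Qed.

Fact supermulDr : right_distributive supermul +%R.
Proof.
move=> F G H; apply/superpolyP => U; rewrite scoefD !scoefE -big_split /=.
by apply: eq_bigr => S _; rewrite scoefD !mulrDr.
Qed.

Fact superone_neq0 : superone != 0.
Proof.
apply/eqP => /superpolyP/(_ set0)/eqP.
by rewrite scoefE scoef0 eqxx oner_eq0.
Qed.

Fact superscaleAl (a : R) F G : a *: supermul F G = supermul (a *: F) G.
Proof.
apply/superpolyP => U; rewrite scoefZ !scoefE scaler_sumr.
by apply: eq_bigr => S _; rewrite scoefZ -scalerAl scalerAr.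
Qed.

Fact superscaleAr (a : R) F G : a *: supermul F G = supermul F (a *: G).
Proof.
apply/superpolyP => U; rewrite scoefZ !scoefE scaler_sumr.
by apply: eq_bigr => S _; rewrite scoefZ -!scalerAr.
Qed.

End Superalgebra.

HB.instance Definition _ (R : comNzRingType) (n : nat) :=
  GRing.Zmodule_isNzRing.Build (superpoly R n)
    (@supermulA R n) (@supermul1l R n) (@supermul1r R n)
    (@supermulDl R n) (@supermulDr R n) (@superone_neq0 R n).
HB.instance Definition _ (R : comNzRingType) (n : nat) :=
  GRing.Lmodule_isLalgebra.Build R (superpoly R n) (@superscaleAl R n).
HB.instance Definition _ (R : comNzRingType) (n : nat) :=
  GRing.Lalgebra_isAlgebra.Build R (superpoly R n) (@superscaleAr R n).

Section Derivations.
Variables (R : comNzRingType) (n : nat).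
Local Notation V := (superpoly R n).
Implicit Types (F G : V) (p : bool).

Definition theta (i : 'I_n) : V := spoly (fun S => (S == [set i])%:R).

Definition dx F : V := spoly (fun S => (scoef F S)^`()).

(* The left derivative: theta_i is moved to the front, then removed. *)
Definition dtheta (i : 'I_n) F : V := spoly (fun S =>
  if i \in S then 0
  else (-1) ^+ #|[set j in S | (j < i)%N]| * scoef F (i |: S)).

Definition eta (i : 'I_n) F : V := dtheta i F - theta i * dx F.

(* Parities are booleans, true being odd. *)
Definition homogeneous p F : Prop :=
  forall S : {set 'I_n}, scoef F S != 0 -> odd #|S| = p.

Definition part p F : V :=
  spoly (fun S => if odd #|S| == p then scoef F S else 0).

(* The linear extension of F |-> (-1)^|F| F. For a linear operator phi, the   *)
(* expression (-1)^|F| phi(F) extends linearly to phi (psign F).              *)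
Definition psign F : V := part false F - part true F.

Lemma homogeneous_part p F : homogeneous p (part p F).
Proof. by move=> S; rewrite scoefE; case: (_ =P p) => // _; rewrite eqxx. Qed.

Lemma part_sum F : part false F + part true F = F.
Proof.
apply/superpolyP => S; rewrite scoefD !scoefE.
by case: (odd #|S|); rewrite /= ?addr0 ?add0r.
Qed.

Lemma part_homogeneous p q F :
  homogeneous p F -> part q F = if q == p then F else 0.
Proof.
move=> hF; apply/superpolyP => S; rewrite scoefE.
have [eqS | neS] := eqVneq (scoef F S) 0.
  by case: (q == p); rewrite ?scoef0 eqS if_same.
by rewrite (hF S neS) eq_sym; case: (q == p); rewrite ?scoef0.
Qed.

Lemma psign_homogeneous p F : homogeneous p F -> psign F = (-1) ^+ p *: F.
Proof.
move=> hF; rewrite /psign !(part_homogeneous _ hF).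
by case: p {hF} => /=; rewrite ?expr0 ?expr1 ?scale1r ?scaleN1r ?subr0 ?sub0r.
Qed.

End Derivations.

Section BinaryOperators.
Variables (R : fieldType) (n : nat).
Local Notation V := (superpoly R n).
Implicit Types (F G H : V) (A : V -> V -> V).

(* The bilinear map                                                           *)
(*   (F, G) |-> (-1)^(e |F|) c (dx^a dtheta_I F) (dx^b dtheta_J G),           *)
(* where I and J are words of odd indices.                                    *)
Record bidiff_term := BidiffTerm {
  bt_coef : V;
  bt_sign : bool;
  bt_dx1 : nat;
  bt_dtheta1 : seq 'I_n;
  bt_dx2 : nat;
  bt_dtheta2 : seq 'I_n
}.

Definition deriv_word (a : nat) (I : seq 'I_n) F : V :=
  iter a (@dx R n) (foldr (@dtheta R n) F I).

Definition bidiff_eval (t : bidiff_term) F G : V :=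
  bt_coef t
  * deriv_word (bt_dx1 t) (bt_dtheta1 t) (if bt_sign t then psign F else F)
  * deriv_word (bt_dx2 t) (bt_dtheta2 t) G.

Definition is_bidiff A : Prop :=
  exists ts : seq bidiff_term,
    forall F G, A F G = \sum_(t <- ts) bidiff_eval t F G.

Definition contact_field H G : V :=
  H * dx G - 2%:R^-1 *: \sum_(i < n) eta i (psign H) * eta i G.

(* The action of contact_field H on densities of weight lambda. *)
Definition lie (lambda : R) H G : V :=
  contact_field H G + lambda *: (dx H * G).

(* The homogeneous component of parity a of a bilinear map. *)
Definition op_part (a : bool) A F G : V :=
  \sum_(f : bool) \sum_(g : bool)
     part (a (+) f (+) g) (A (part f F) (part g G)).

(* The action of contact_field H on A when A, H, F have parities a, h, f. *)
Definition hom_action (lambda mu nu : R) (a h f : bool) H A F G : V :=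
  lie nu H (A F G)
  - (-1) ^+ (a && h) *: (A (lie lambda H F) G
                         + (-1) ^+ (f && h) *: A F (lie mu H G)).

(* Its multilinear extension to operators and arguments of mixed parity. *)
Definition contact_action (lambda mu nu : R) H A F G : V :=
  \sum_(a : bool) \sum_(h : bool) \sum_(f : bool)
     hom_action lambda mu nu a h f (part h H) (op_part a A) (part f F) G.

Definition contact_invariant (lambda mu nu : R) A : Prop :=
  forall H F G, contact_action lambda mu nu H A F G = 0.

Definition op_a F G : V := F * G.

Definition op_b (lambda mu : R) F G : V :=
  mu *: (dx F * G) - lambda *: (F * dx G)
  - 2%:R^-1 *: \sum_(i < n) eta i (psign F) * eta i G.

(* In the remaining operators i and j are the two odd indices when n = 2. *)
Definition eta_wedge (i j : 'I_n) F G : V :=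
  eta i (psign F) * eta j G - eta j (psign F) * eta i G.

Definition op_c (mu : R) (i j : 'I_n) F G : V :=
  eta_wedge i j F G + (2%:R * mu) *: (eta j (eta i F) * G).

Definition op_d (lambda : R) (i j : 'I_n) F G : V :=
  eta_wedge i j F G + (2%:R * lambda) *: (F * eta j (eta i G)).

Definition op_e (lambda : R) (i j : 'I_n) F G : V :=
  (lambda + 2%:R^-1) *: eta_wedge i j F G
  + lambda *: (F * eta i (eta j G)) + (lambda + 1) *: (eta i (eta j F) * G).

End BinaryOperators.

(* Main.v *)
(* Let phi(F, G) be the value of T(F, G) at the origin. Since T commutes with
   the translations 1 and theta_i, it is determined by phi. The fields of the
   Hamiltonians x, theta_i theta_j, x theta_i, x theta_i theta_j and
   theta_i theta_j theta_k vanish at the origin, so invariance under them is a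
   linear system for the numbers phi(x^a theta_S, x^b theta_S').
   The rotations theta_i theta_j leave only S' = S and S' equal to the
   complement of S. If S' = S, the system forces a + b + #|S| <= 1; the field x
   then gives nu - lambda - mu = a + b + #|S|, and the solutions are the values
   of op_a and op_b. If S' is the complement of S, there is no nonzero solution
   for n > 2, while for n = 2 only a = b = 0 survives, with a 3 by 3 system of
   determinant proportional to lambda * mu * nu. *)
Require Import Defs.
From mathcomp Require Import all_boot all_order all_algebra reals ring lra zify.

Import Order.TTheory GRing.Theory Num.Theory.
Local Open Scope ring_scope.

(** * Calculus of superpolynomials *)

Section Calculus.
Set Implicit Arguments.
Unset Strict Implicit.
Variables (R : comNzRingType) (n : nat).
Local Notation V := (superpoly R n).
Implicit Types (F G H : V) (S T U : {set 'I_n}) (p q : {poly R}) (i j k l : 'I_n).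

(** Two obstacles shape the work. [T] need not be homogeneous, and its invariance is a sum over
    parity components with signs. Conjugation by the parity involution [psign] multiplies a
    component of parity [a] by [(-1)^a], so for homogeneous [H] the signs can be absorbed and the
    condition becomes an identity about [T] itself. The weights are arbitrary reals, so a
    coefficient containing [lambda] or [mu] cannot be divided by. Every elimination therefore
    combines equations until the weights cancel and a positive number is left in front of the
    unknown; this is where the order of the field enters. Only in the 3 by 3 system do the weights
    survive, and there the exceptional operators appear. Signs from reordering odd variables are
    kept local by using words: a letter is always brought to the front before a field acts on it.
    Sets return only to compare supports. In the end [T] minus a candidate operator commutes with
    translations and has zero values at the origin, hence vanishes; the candidates enter only
    through their translation equivariance and these values. *)

Definition nlt (i : 'I_n) S : nat := #|[set j in S | (j < i)%N]|.

Lemma nltE i S : nlt i S = (\sum_(j in S) (j < i))%N.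
Proof.
rewrite /nlt -sum1_card big_mkcond [RHS]big_mkcond /=.
by apply: eq_bigr => j _; rewrite inE; case: (j \in S); case: (j < i)%N.
Qed.

Lemma nltU1 i j S : j \notin S -> nlt i (j |: S) = ((j < i) + nlt i S)%N.
Proof. by move=> jS; rewrite !nltE big_setU1. Qed.

Lemma nltD1 i j S : j \in S -> nlt i S = ((j < i) + nlt i (S :\ j))%N.
Proof. by move=> jS; rewrite -nltU1 ?setD11 // setD1K. Qed.

Lemma scoef_dtheta i F S :
  scoef (dtheta i F) S = if i \in S then 0 else (-1) ^+ nlt i S * scoef F (i |: S).
Proof. by rewrite scoefE. Qed.

Lemma scoef_dx F S : scoef (dx F) S = (scoef F S)^`().
Proof. by rewrite scoefE. Qed.

Lemma scoefM F G U : scoef (F * G) U = \sum_(S : {set 'I_n} | S \subset U)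
  (-1) ^+ ninv S (U :\: S) * (scoef F S * scoef G (U :\: S)).
Proof. exact: scoefE. Qed.

Lemma scoef_theta i S : scoef (theta R i) S = (S == [set i])%:R.
Proof. exact: scoefE. Qed.

Lemma scoef_sum I (r : seq I) (P : pred I) (F : I -> V) S :
  scoef (\sum_(i <- r | P i) F i) S = \sum_(i <- r | P i) scoef (F i) S.
Proof.
by apply: (big_morph (fun F => scoef F S) (id1 := 0)) => [x y|]; rewrite ?scoefD ?scoef0.
Qed.

Lemma scoef_psign F S : scoef (psign F) S = (-1) ^+ #|S| * scoef F S.
Proof.
rewrite /psign scoefD scoefN !scoefE -signr_odd.
by case: (odd #|S|); rewrite /= ?expr0 ?expr1 ?mul1r ?mulN1r ?subr0 ?sub0r.
Qed.

Lemma scoef_thetaM i F S : scoef (theta R i * F) S =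
  if i \in S then (-1) ^+ nlt i S * scoef F (S :\ i) else 0.
Proof.
rewrite scoefM; case: ifP => iS; last first.
  rewrite big1 // => T sTS; rewrite scoef_theta.
  case: eqP => [eT|]; last by rewrite mul0r mulr0.
  by move: sTS; rewrite eT sub1set iS.
rewrite (bigD1 [set i]) ?sub1set //= scoef_theta eqxx mul1r big1 ?addr0.
  congr (_ ^+ _ * _); rewrite /ninv big_set1 -nltE nltE [RHS]nltE.
  by rewrite [RHS](big_setD1 i) //= ltnn.
by move=> T /andP[_ /negPf nT]; rewrite scoef_theta nT mul0r mulr0.
Qed.

Lemma scoefMtheta i F S : scoef (F * theta R i) S =
  if i \in S then (-1) ^+ (nlt i S + #|S|.-1) * scoef F (S :\ i) else 0.
Proof.
rewrite scoefM; case: ifP => iS; last first.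
  rewrite big1 // => T sTS; rewrite scoef_theta.
  case: eqP => [eT|]; last by rewrite !mulr0.
  by have := in_setD S T i; rewrite eT inE eqxx iS andbF.
have sSi : S :\: (S :\ i) = [set i].
  by apply/setP => j; rewrite !inE; case: eqVneq => [->|]; rewrite ?iS // andNb.
rewrite (bigD1 (S :\ i)) ?subD1set //= scoef_theta sSi eqxx mulr1 big1 ?addr0.
  congr (_ * _); rewrite -signr_odd -[RHS]signr_odd; congr (_ ^+ nat_of_bool _).
  rewrite (nltD1 i iS) ltnn add0n (cardsD1 i S) iS add1n /=.
  rewrite -[#|S :\ i|]sum1_card nltE /ninv -big_split /=.
  (* For [j != i] exactly one of [j < i] and [i < j] holds; the summand [(j < i) * 2], invisible
     modulo 2, turns this into an equality of naturals. *)
  have -> : (\sum_(j in S :\ i) ((j < i) + 1) =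
    \sum_(j in S :\ i) \sum_(k in [set i]) (k < j) + \sum_(j in S :\ i) (j < i) * 2)%N.
    rewrite -big_split /=; apply: eq_bigr => j; rewrite !inE => /andP[nji _].
    rewrite big_set1; have: (j : nat) != i by []. by case: ltngtP.
  by rewrite -big_distrl /= muln2 oddD odd_double addbF.
move=> T /andP[sTS /eqP nT]; rewrite scoef_theta.
case: eqP => [eT|]; last by rewrite !mulr0.
case: nT; rewrite -eT; apply/setP=> j; rewrite !inE.
by have := subsetP sTS j; case: (j \in T) => // [->|]; rewrite //= ?andNb.
Qed.

(** Supercommutativity for [F] of mixed parity: [psign] stands for the sign that a homogeneous
    factor would produce. *)
Lemma Mtheta i F : F * theta R i = theta R i * psign F.
Proof.
apply/superpolyP => S; rewrite scoefMtheta scoef_thetaM scoef_psign.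
case: ifP => // iS; rewrite exprD mulrA; congr (_ * _ ^+ _ * _).
by rewrite (cardsD1 i S) iS.
Qed.

Lemma psignM F G : psign (F * G) = psign F * psign G.
Proof.
apply/superpolyP => U; rewrite scoef_psign !scoefM mulr_sumr.
apply: eq_bigr => S sSU; rewrite !scoef_psign -(cardsID S U) (setIidPr sSU) exprD.
by ring.
Qed.

Lemma psignK F : psign (psign F) = F.
Proof.
apply/superpolyP => S; rewrite !scoef_psign mulrA -expr2 -exprM mulnC exprM.
by rewrite sqrrN expr1n expr1n mul1r.
Qed.

Lemma psignD F G : psign (F + G) = psign F + psign G.
Proof. by apply/superpolyP => S; rewrite !(scoefD, scoef_psign) mulrDr. Qed.
Lemma psignN F : psign (- F) = - psign F.
Proof. by apply/superpolyP => S; rewrite !(scoefN, scoef_psign) mulrN. Qed.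
Lemma psign0 : psign (0 : V) = 0.
Proof. by apply/superpolyP => S; rewrite !(scoef0, scoef_psign) mulr0. Qed.
Lemma psignZ (c : R) F : psign (c *: F) = c *: psign F.
Proof. by apply/superpolyP => S; rewrite !(scoefZ, scoef_psign) scalerAr. Qed.
Lemma psign_theta i : psign (theta R i) = - theta R i.
Proof.
apply/superpolyP => S; rewrite scoefN scoef_psign scoef_theta.
by case: eqP => [->|]; rewrite ?cards1 ?expr1 ?mulN1r // mulr0 oppr0.
Qed.

Lemma dxD F G : dx (F + G) = dx F + dx G.
Proof. by apply/superpolyP => S; rewrite !(scoefD, scoef_dx) derivD. Qed.
Lemma dxN F : dx (- F) = - dx F.
Proof. by apply/superpolyP => S; rewrite !(scoefN, scoef_dx) derivN. Qed.
Lemma dx0 : dx (0 : V) = 0.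
Proof. by apply/superpolyP => S; rewrite !(scoef0, scoef_dx) deriv0. Qed.
Lemma dxZ (c : R) F : dx (c *: F) = c *: dx F.
Proof. by apply/superpolyP => S; rewrite !(scoefZ, scoef_dx) derivZ. Qed.
Lemma dx_psign F : dx (psign F) = psign (dx F).
Proof.
apply/superpolyP => S; rewrite !(scoef_psign, scoef_dx) -signr_odd.
by case: odd; rewrite /= ?expr0 ?expr1 ?mul1r ?mulN1r ?derivN.
Qed.
Lemma dxM F G : dx (F * G) = dx F * G + F * dx G.
Proof.
apply/superpolyP => U; rewrite scoefD !scoefM scoef_dx scoefM.
rewrite -big_split /= raddf_sum; apply: eq_bigr => S _; rewrite !scoef_dx /=.
by rewrite -signr_odd; case: odd; rewrite /= ?expr0 ?expr1 ?mul1r ?mulN1r ?derivN ?derivM; ring.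
Qed.
Lemma dx_theta i : dx (theta R i) = 0.
Proof.
apply/superpolyP => S; rewrite scoef_dx scoef_theta scoef0.
by case: eqP => _; rewrite ?deriv0 // -[1%:R]/(1%:P) derivC.
Qed.

Lemma dthetaD i F G : dtheta i (F + G) = dtheta i F + dtheta i G.
Proof.
apply/superpolyP => S; rewrite !(scoefD, scoef_dtheta).
by case: ifP; rewrite ?addr0 ?mulrDr.
Qed.
Lemma dthetaZ i (c : R) F : dtheta i (c *: F) = c *: dtheta i F.
Proof.
apply/superpolyP => S; rewrite !(scoefZ, scoef_dtheta).
by case: ifP => _; [rewrite scaler0 | rewrite scalerAr].
Qed.
Lemma dthetaN i F : dtheta i (- F) = - dtheta i F.
Proof. by rewrite -scaleN1r dthetaZ scaleN1r. Qed.
Lemma dtheta0 i : dtheta i (0 : V) = 0.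
Proof. by have := dthetaZ i 0 0; rewrite !scale0r. Qed.
Lemma dtheta_psign i F : dtheta i (psign F) = - psign (dtheta i F).
Proof.
apply/superpolyP => S; rewrite scoefN scoef_psign !scoef_dtheta scoef_psign.
case: ifP => iS; first by rewrite mulr0 oppr0.
by rewrite cardsU1 iS exprS; ring.
Qed.
Lemma dx_dtheta i F : dx (dtheta i F) = dtheta i (dx F).
Proof.
apply/superpolyP => S; rewrite scoef_dx !scoef_dtheta scoef_dx.
case: ifP => _; first exact: deriv0.
by rewrite -signr_odd; case: odd; rewrite /= ?expr0 ?expr1 ?mul1r ?mulN1r ?derivN.
Qed.

(** The Clifford relation. The Leibniz rule, the anticommutation of the [dtheta] and the Euler field
    are all derived from it by peeling letters off words, without further counting of inversions. *)
Lemma dtheta_thetaM l i F :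
  dtheta l (theta R i * F) = (if l == i then F else 0) - theta R i * dtheta l F.
Proof.
apply/superpolyP => S; rewrite scoefD scoefN scoef_dtheta !scoef_thetaM.
rewrite in_setU1 scoef_dtheta.
have [->|nli] := eqVneq l i.
  rewrite /= setD11; case: ifP => iS.
    by rewrite (nltD1 i iS) ltnn add0n signrMK setD1K // subrr.
  by rewrite (nltU1 i (negbT iS)) ltnn add0n signrMK setU1K ?iS // subr0.
rewrite /= scoef0 sub0r; case: (boolP (l \in S)) => lS.
  by case: ifP => _; rewrite ?inE ?nli ?lS /= ?mulr0 ?oppr0.
case: ifP => iS; last by rewrite mulr0 oppr0.
rewrite !inE nli (negPf lS) /= (nltU1 i lS) (nltD1 l iS) !exprD.
have -> : (l |: S) :\ i = l |: S :\ i.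
  by apply/setP => j; rewrite !inE; case: eqVneq => [->|]; rewrite ?(negPf nli) //= eq_sym (negPf nli).
have: (l : nat) != i by [].
by case: ltngtP => // _ _; rewrite ?expr0 ?expr1; ring.
Qed.

End Calculus.

(** * Words in the odd variables *)

Section Words.
Set Implicit Arguments.
Unset Strict Implicit.
Variables (R : comNzRingType) (n : nat).
Local Notation V := (superpoly R n).
Implicit Types (F G H : V) (S T U : {set 'I_n}) (p q : {poly R}) (i j k l : 'I_n).
Implicit Types (s t : seq 'I_n).

Lemma thetaC i j : theta R i * theta R j = - (theta R j * theta R i).
Proof. by rewrite [LHS]Mtheta psign_theta mulrN. Qed.

Lemma theta_swap i j F : theta R i * (theta R j * F) = - (theta R j * (theta R i * F)).
Proof. by rewrite !mulrA thetaC mulNr. Qed.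

Lemma thetaK i F : theta R i * (theta R i * F) = 0.
Proof.
by apply/superpolyP => S; rewrite !scoef_thetaM setD11 mulr0 if_same scoef0.
Qed.

Lemma dx_thetaM i F : dx (theta R i * F) = theta R i * dx F.
Proof. by rewrite dxM dx_theta mul0r add0r. Qed.

Definition cst p : V := spoly (fun S => if S == set0 then p else 0).

Lemma scoef_cstM p F S : scoef (cst p * F) S = p * scoef F S.
Proof.
rewrite scoefM (bigD1 set0) ?sub0set //= scoefE eqxx setD0 ninv0l expr0 mul1r.
by rewrite big1 ?addr0 // => T /andP[_ /negPf nT]; rewrite scoefE nT mul0r mulr0.
Qed.

Lemma scoef_Mcst p F S : scoef (F * cst p) S = p * scoef F S.
Proof.
rewrite scoefM (bigD1 S) //= scoefE setDv eqxx ninv0r expr0 mul1r mulrC.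
rewrite big1 ?addr0 // => T /andP[sTS nTS]; rewrite scoefE setD_eq0.
have /negPf -> : ~~ (S \subset T); last by rewrite !mulr0.
by apply: contra nTS => sST; rewrite eqEsubset sTS.
Qed.

Lemma cstC p F : F * cst p = cst p * F.
Proof. by apply/superpolyP => S; rewrite scoef_Mcst scoef_cstM. Qed.

Lemma cst_thetaM p i F : cst p * (theta R i * F) = theta R i * (cst p * F).
Proof. by rewrite !mulrA cstC. Qed.

Lemma cstMM p q F : cst p * (cst q * F) = cst (p * q) * F.
Proof. by apply/superpolyP => S; rewrite !scoef_cstM mulrA. Qed.

Lemma dx_cst p : dx (cst p) = cst p^`().
Proof.
by apply/superpolyP => S; rewrite scoef_dx !scoefE; case: eqP; rewrite ?deriv0.
Qed.

Lemma psign_cst p : psign (cst p) = cst p.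
Proof.
apply/superpolyP => S; rewrite scoef_psign scoefE.
by case: eqP => [->|_]; rewrite ?mulr0 // cards0 mul1r.
Qed.

Lemma dtheta_cst i p : dtheta i (cst p) = 0.
Proof.
apply/superpolyP => S; rewrite scoef_dtheta scoefE scoef0.
by case: eqP => [/setP/(_ i)|_]; rewrite ?mulr0 ?if_same // !inE eqxx.
Qed.

Lemma dtheta_cstM l p F : dtheta l (cst p * F) = cst p * dtheta l F.
Proof.
apply/superpolyP => S; rewrite scoef_dtheta !scoef_cstM scoef_dtheta.
by case: ifP; rewrite ?mulr0 // mulrCA.
Qed.

(** Words rather than sets, so that bringing a letter to the front is a swap with an explicit sign.
    A repeated letter gives zero. The lock keeps the product from being unfolded during
    unification. *)
Definition wmon a s : V := locked (cst 'X^a * \prod_(i <- s) theta R i).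

Lemma wmonE a s : wmon a s = cst 'X^a * \prod_(i <- s) theta R i.
Proof. by rewrite /wmon -lock. Qed.

Lemma wmon_nil a : wmon a [::] = cst 'X^a.
Proof. by rewrite wmonE big_nil mulr1. Qed.

Lemma wmon_cons a i s : wmon a (i :: s) = theta R i * wmon a s.
Proof. by rewrite !wmonE big_cons cst_thetaM. Qed.

Lemma wmonS a s : cst 'X * wmon a s = wmon a.+1 s.
Proof. by rewrite !wmonE cstMM exprS. Qed.

Lemma psign_wmon a s : psign (wmon a s) = (-1) ^+ size s *: wmon a s.
Proof.
elim: s => [|i s IHs]; first by rewrite wmon_nil psign_cst scale1r.
by rewrite wmon_cons psignM psign_theta IHs -scalerAr mulNr exprS mulN1r scaleNr scalerN.
Qed.

Lemma dx_wmon a s : dx (wmon a s) = a%:R *: wmon a.-1 s.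
Proof.
elim: s => [|i s IHs]; last by rewrite !wmon_cons dx_thetaM IHs -scalerAr.
rewrite !wmon_nil dx_cst derivXn.
by apply/superpolyP => S; rewrite scoefZ !scoefE; case: ifP; rewrite ?scaler0 ?scaler_nat.
Qed.

Lemma dtheta_wmon a l s : l \notin s -> dtheta l (wmon a s) = 0.
Proof.
elim: s => [_|i s IHs]; first by rewrite wmon_nil dtheta_cst.
rewrite inE negb_or => /andP[/negPf nli /IHs IH].
by rewrite wmon_cons dtheta_thetaM nli IH mulr0 subr0.
Qed.

Lemma dtheta_wmon_head a i s : i \notin s -> dtheta i (wmon a (i :: s)) = wmon a s.
Proof. by move=> nis; rewrite wmon_cons dtheta_thetaM eqxx dtheta_wmon // mulr0 subr0. Qed.

Definition mon a S : V := spoly (fun T => if T == S then 'X^a else 0).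

(** The sign is left unspecified: what passes between words and sets is that words without
    repetition span, and that values on them vanish. *)
Lemma wmon_mon a s : uniq s ->
  exists b : bool, wmon a s = (-1) ^+ b *: mon a [set x in s].
Proof.
elim: s => [_|i s IHs].
  exists false; rewrite wmon_nil scale1r; apply/superpolyP => S; rewrite !scoefE.
  by congr (if _ then _ else _); congr (_ == _); apply/setP => x; rewrite !inE.
move=> /= /andP[nis /IHs [b eb]]; set S := [set x in s] in eb.
exists (odd (b + nlt i (i |: S))).
rewrite wmon_cons eb; apply/superpolyP => T; rewrite -scalerAr !scoefZ scoef_thetaM !scoefE.
have -> : [set x in i :: s] = i |: S by apply/setP => x; rewrite !inE.
have niS : i \notin S by rewrite inE.
have -> : (T == i |: S) = (i \in T) && (T :\ i == S).
  apply/eqP/andP => [-> | [iT /eqP <-]]; last by rewrite setD1K.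
  by rewrite setU1K // setU11.
case: ifP => iT /=; last by rewrite !scaler0.
case: eqP => [eT|_]; last by rewrite mulr0 !scaler0.
have sgn m (p : {poly R}) : (-1) ^+ m * p = (-1) ^+ m *: p.
  by rewrite -signr_odd -[in RHS]signr_odd; case: odd; rewrite ?expr1 ?mulN1r ?scaleN1r ?expr0 ?mul1r ?scale1r.
by rewrite -eT setD1K // sgn scalerA -exprD signr_odd.
Qed.

Lemma superpoly_sum_mon F :
  F = \sum_(S : {set 'I_n}) \sum_(a < size (scoef F S)) (scoef F S)`_a *: mon a S.
Proof.
apply/superpolyP => T; rewrite scoef_sum (bigD1 T) //= scoef_sum [X in _ + X]big1.
  rewrite addr0 -[LHS]coefK poly_def; apply: eq_bigr => a _.
  by rewrite scoefZ scoefE eqxx.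
move=> S /negPf nST; rewrite scoef_sum big1 // => a _.
by rewrite scoefZ scoefE eq_sym nST scaler0.
Qed.

Lemma mon_ind (P : V -> Prop) : P 0 -> (forall F G, P F -> P G -> P (F + G)) ->
  (forall (c : R) F, P F -> P (c *: F)) -> (forall a S, P (mon a S)) -> forall F, P F.
Proof.
move=> P0 PD PZ Pm F; rewrite [F]superpoly_sum_mon.
by elim/big_ind: _ => // S _; elim/big_ind: _ => // a _; apply: PZ.
Qed.

Lemma mon_wmon a s : uniq s ->
  exists b : bool, mon a [set x in s] = (-1) ^+ b *: wmon a s.
Proof.
move=> /(wmon_mon a)[b ->]; exists b.
by rewrite scalerA -expr2 -exprM mulnC exprM sqrrN expr1n expr1n scale1r.
Qed.

Lemma wmon_ind (P : V -> Prop) : P 0 -> (forall F G, P F -> P G -> P (F + G)) ->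
  (forall (c : R) F, P F -> P (c *: F)) ->
  (forall a s, uniq s -> P (wmon a s)) -> forall F, P F.
Proof.
move=> P0 PD PZ Pm; apply: mon_ind => // a S.
have [b] := mon_wmon a (enum_uniq (mem S)); rewrite set_enum => ->.
exact/PZ/Pm/enum_uniq.
Qed.

Lemma dthetaM l F G : dtheta l (F * G) = dtheta l F * G + psign F * dtheta l G.
Proof.
elim/wmon_ind: F G => [G|F1 F2 IH1 IH2 G|c F IH G|a s _].
- by rewrite !(mul0r, dtheta0, psign0) addr0.
- rewrite (mulrDl F1) !dthetaD psignD (mulrDl (dtheta l F1)) (mulrDl (psign F1)).
  by rewrite IH1 IH2 addrACA.
- by rewrite -scalerAl !dthetaZ psignZ -!scalerAl IH scalerDr.
elim: s => [|i s IHs] G.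
  by rewrite wmon_nil dtheta_cstM dtheta_cst psign_cst mul0r add0r.
rewrite wmon_cons -mulrA !dtheta_thetaM IHs psignM psign_theta.
rewrite (mulrDr (theta R i)) (mulrBl G) mulNr mulNr opprD addrA !mulrA.
by case: ifP => _; rewrite ?mul0r.
Qed.

Lemma dthetaC i j F : dtheta i (dtheta j F) = - dtheta j (dtheta i F).
Proof.
elim/wmon_ind: F => [|F1 F2 IH1 IH2|c F IH|a s _].
- by rewrite !dtheta0 oppr0.
- by rewrite !dthetaD IH1 IH2 opprD.
- by rewrite !dthetaZ IH scalerN.
elim: s => [|k s IHs]; first by rewrite wmon_nil !dtheta_cst !dtheta0 oppr0.
have e l m : dtheta l (if m == k then wmon a s else 0) =
    if m == k then dtheta l (wmon a s) else 0 by case: ifP; rewrite // dtheta0.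
rewrite wmon_cons !dtheta_thetaM !(dthetaD, dthetaN) !dtheta_thetaM !e IHs.
by rewrite mulrN opprK opprB opprD addrA addrAC.
Qed.

(** The Euler field of the odd variables, counting the odd degree. It gathers the cross terms of
    [eta l (psign H) * eta l F]. *)
Definition euler F : V := \sum_(l < n) theta R l * dtheta l F.

Lemma euler_thetaM i F : euler (theta R i * F) = theta R i * F + theta R i * euler F.
Proof.
rewrite /euler mulr_sumr; under eq_bigr do rewrite dtheta_thetaM mulrBr.
rewrite big_split /= (bigD1 i) //= eqxx big1 ?addr0; last first.
  by move=> l /negPf ->; rewrite mulr0.
congr (_ + _); apply: eq_bigr => l _.
by rewrite !mulrA thetaC mulNr.
Qed.

Lemma euler_wmon a s : euler (wmon a s) = (size s)%:R *: wmon a s.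
Proof.
elim: s => [|i s IHs]; last by rewrite wmon_cons euler_thetaM IHs -scalerAr -natr1 scalerDl scale1r addrC.
by rewrite wmon_nil /euler big1 ?scale0r // => l _; rewrite dtheta_cst mulr0.
Qed.

End Words.

(** * The contact action through the Euler field *)

Section Contact.
Set Implicit Arguments.
Unset Strict Implicit.
Variables (R : fieldType) (n : nat).
Hypothesis two_neq0 : 2%:R != 0 :> R.
Local Notation V := (superpoly R n).
Implicit Types (F G H : V) (i j k l : 'I_n).

(** Expand each product of two [eta l]. The term with [theta R l] twice vanishes, the two mixed
    terms sum to [euler H * dx F] and [dx H * euler F], and only the derivatives [dtheta l] remain
    as a sum. *)
Lemma lieE lambda H F : 2%:R *: lie lambda H F =
  2%:R *: (H * dx F) - euler H * dx F + dx H * (euler F + (2%:R * lambda) *: F)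
  - \sum_l dtheta l (psign H) * dtheta l F.
Proof.
rewrite /lie /contact_field !scalerDr scalerN !scalerA divff // scale1r.
rewrite /euler mulr_suml mulrDr mulr_sumr -!addrA; congr (_ + _).
rewrite !addrA [RHS]addrAC; congr (_ + _); last exact: scalerAr.
rewrite -!sumrN -!big_split /=; apply: eq_bigr => l _.
have e1 : dtheta l (psign H) * (theta R l * dx F) = - (theta R l * dtheta l H * dx F).
  by rewrite mulrA Mtheta dtheta_psign psignN psignK mulrN mulNr.
have e2 G : theta R l * dx (psign H) * G = dx H * (theta R l * G).
  by rewrite mulrA Mtheta dx_psign.
rewrite /eta mulrBl !mulrBr e1 !e2 thetaK mulr0 subr0 opprK !opprD opprK.
by rewrite [RHS]addrC addrA.
Qed.

End Contact.

(** * Contact fields of monomials *)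

Section ContactWords.
Set Implicit Arguments.
Unset Strict Implicit.
Variables (R : fieldType) (n : nat).
Hypothesis two_neq0 : 2%:R != 0 :> R.
Local Notation V := (superpoly R n).
Implicit Types (F G H : V) (i j k l : 'I_n) (lambda : R) (s t : seq 'I_n).

(** The factor 2 clears the one half in the contact field, so that on monomials only integers and
    [2 lambda] occur. *)
Definition lie2 lambda H F : V := 2%:R *: lie lambda H F.

Lemma lie2_wmon lambda c s F : lie2 lambda (wmon R c s) F =
  (2%:R - (size s)%:R) *: (wmon R c s * dx F)
  + c%:R *: (wmon R c.-1 s * (euler F + (2%:R * lambda) *: F))
  - (-1) ^+ size s *: \sum_l dtheta l (wmon R c s) * dtheta l F.
Proof.
rewrite /lie2 lieE // euler_wmon dx_wmon psign_wmon -!scalerAl scalerBl scaler_sumr.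
by congr (_ - _); apply: eq_bigr => l _; rewrite dthetaZ scalerAl.
Qed.

Lemma sum_eq_mul (i : 'I_n) (A : V) (B : 'I_n -> V) :
  \sum_l (if l == i then A else 0) * B l = A * B i.
Proof.
rewrite (bigD1 i) //= eqxx big1 ?addr0 // => l /negPf ->.
by rewrite mul0r.
Qed.

Lemma lie2_one lambda F : lie2 lambda (wmon R 0 [::]) F = 2%:R *: dx F.
Proof.
rewrite lie2_wmon scale0r addr0 subr0 wmon_nil big1 => [|l _]; last first.
  by rewrite dtheta_cst mul0r.
rewrite scaler0 subr0; congr (_ *: _); apply/superpolyP => S.
by rewrite scoef_cstM expr0 mul1r.
Qed.

Lemma cst1M F : cst n (1 : {poly R}) * F = F.
Proof. by apply/superpolyP => S; rewrite scoef_cstM mul1r. Qed.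

Lemma lie2_x lambda F : lie2 lambda (wmon R 1 [::]) F =
  2%:R *: (cst n 'X * dx F) + (euler F + (2%:R * lambda) *: F).
Proof.
rewrite lie2_wmon !wmon_nil big1 => [|l _]; last by rewrite dtheta_cst mul0r.
by rewrite /= expr0 cst1M scale1r scaler0 !subr0 expr1.
Qed.

Lemma sum_dtheta1 c i F :
  \sum_l dtheta l (wmon R c [:: i]) * dtheta l F = cst n 'X^c * dtheta i F.
Proof.
under eq_bigr do rewrite wmon_cons dtheta_thetaM wmon_nil dtheta_cst mulr0 subr0.
exact: sum_eq_mul.
Qed.

Lemma sum_dtheta2 c i j F :
  \sum_l dtheta l (wmon R c [:: i; j]) * dtheta l F =
  wmon R c [:: j] * dtheta i F - wmon R c [:: i] * dtheta j F.
Proof.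
under eq_bigr => l _ do rewrite wmon_cons dtheta_thetaM (mulrBl (dtheta l F)) -mulrA.
rewrite sumrB sum_eq_mul -mulr_sumr sum_dtheta1 mulrA -wmon_nil.
by rewrite [in RHS](wmon_cons _ c i).
Qed.

Lemma sum_dtheta3 c i j k F :
  \sum_l dtheta l (wmon R c [:: i; j; k]) * dtheta l F =
  wmon R c [:: j; k] * dtheta i F -
  (wmon R c [:: i; k] * dtheta j F - wmon R c [:: i; j] * dtheta k F).
Proof.
under eq_bigr => l _ do rewrite wmon_cons dtheta_thetaM (mulrBl (dtheta l F)) -mulrA.
rewrite sumrB sum_eq_mul -mulr_sumr sum_dtheta2 mulrBr !mulrA.
by rewrite [wmon R c [:: i; k]]wmon_cons [wmon R c [:: i; j]]wmon_cons.
Qed.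

Lemma lie2_theta lambda i F :
  lie2 lambda (wmon R 0 [:: i]) F = theta R i * dx F + dtheta i F.
Proof.
rewrite lie2_wmon sum_dtheta1 scale0r addr0 expr0 cst1M expr1 scaleN1r opprK.
by rewrite [2%:R](_ : _ = 1 + 1) // addrK scale1r wmon_cons wmon_nil expr0 -mulrA cst1M.
Qed.

Lemma lie2_xtheta lambda i F : lie2 lambda (wmon R 1 [:: i]) F =
  theta R i * (cst n 'X * dx F + (euler F + (2%:R * lambda) *: F)) + cst n 'X * dtheta i F.
Proof.
rewrite lie2_wmon sum_dtheta1 scale1r expr1 scaleN1r opprK.
rewrite [2%:R - _](_ : _ = 1) ?scale1r; last by rewrite -natr1 addrK.
by rewrite !wmon_cons !wmon_nil expr1 expr0 -!mulrA cst1M -mulrDr.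
Qed.

(** For two letters the coefficient [2 - size s] of [dx] is zero, and without [x] there is no weight
    term: what remains is an infinitesimal rotation, the same for all densities. *)
Lemma lie2_rot lambda i j F : lie2 lambda (wmon R 0 [:: i; j]) F =
  theta R i * dtheta j F - theta R j * dtheta i F.
Proof.
rewrite lie2_wmon sum_dtheta2 subrr !scale0r !add0r sqrrN expr1n scale1r opprB.
by rewrite !wmon_cons wmon_nil expr0 -!mulrA !cst1M.
Qed.

Lemma lie2_xrot lambda i j F : lie2 lambda (wmon R 1 [:: i; j]) F =
  theta R i * (theta R j * (euler F + (2%:R * lambda) *: F))
  - cst n 'X * (theta R j * dtheta i F - theta R i * dtheta j F).
Proof.
rewrite lie2_wmon sum_dtheta2 subrr !scale0r !add0r sqrrN expr1n !scale1r.
by rewrite !wmon_cons !wmon_nil expr0 expr1 mulrBr !cst_thetaM -!mulrA !cst1M.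
Qed.

Lemma lie2_cubic lambda i j k F : lie2 lambda (wmon R 0 [:: i; j; k]) F =
  - (theta R i * (theta R j * (theta R k * dx F)))
  + theta R j * (theta R k * dtheta i F)
  - (theta R i * (theta R k * dtheta j F) - theta R i * (theta R j * dtheta k F)).
Proof.
rewrite lie2_wmon sum_dtheta3 scale0r addr0 -signr_odd expr1 scaleN1r opprK.
have -> : 2%:R - (size [:: i; j; k])%:R = -1 :> R.
  by rewrite /=; ring.
by rewrite scaleN1r addrA !wmon_cons wmon_nil expr0 -!mulrA !cst1M.
Qed.

End ContactWords.

(** * Equivariance of an invariant operator *)

Section Linear.
Set Implicit Arguments.
Unset Strict Implicit.
Variables (R : comNzRingType) (n : nat).
Local Notation V := (superpoly R n).
Implicit Types (F G H : V) (f g : V -> V) (i : 'I_n).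

Lemma lin0 f : linear f -> f 0 = 0.
Proof. by move=> /(_ (-1) 0 0); rewrite !scaleN1r oppr0 addr0 addNr. Qed.
Lemma linD f F G : linear f -> f (F + G) = f F + f G.
Proof. by move=> /(_ 1 F G); rewrite !scale1r. Qed.
Lemma linZ f (c : R) F : linear f -> f (c *: F) = c *: f F.
Proof. by move=> hf; have := hf c F 0; rewrite (lin0 hf) !addr0. Qed.
Lemma linN f F : linear f -> f (- F) = - f F.
Proof. by move=> hf; rewrite -scaleN1r (linZ _ _ hf) scaleN1r. Qed.

Lemma lin_id : linear (fun F : V => F).
Proof. by []. Qed.
Lemma lin_comp f g : linear f -> linear g -> linear (fun F => f (g F)).
Proof. by move=> hf hg c F G; rewrite hg hf. Qed.
Lemma lin_add f g : linear f -> linear g -> linear (fun F => f F + g F).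
Proof. by move=> hf hg c F G; rewrite hg hf scalerDr addrACA. Qed.
Lemma lin_opp f : linear f -> linear (fun F => - f F).
Proof. by move=> hf c F G; rewrite hf opprD scalerN. Qed.
Lemma lin_scale (c : R) f : linear f -> linear (fun F => c *: f F).
Proof. by move=> hf d F G; rewrite hf scalerDr !scalerA mulrC. Qed.
Lemma lin_mull H f : linear f -> linear (fun F => H * f F).
Proof. by move=> hf d F G; rewrite hf mulrDr scalerAr. Qed.
Lemma lin_mulr H f : linear f -> linear (fun F => f F * H).
Proof. by move=> hf d F G; rewrite hf mulrDl scalerAl. Qed.
Lemma lin_sum I (r : seq I) (f : I -> V -> V) :
  (forall k, linear (f k)) -> linear (fun F => \sum_(k <- r) f k F).
Proof.
move=> hf c F G; rewrite scaler_sumr -big_split /=.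
by apply: eq_bigr => k _; apply: hf.
Qed.
Lemma lin_dx f : linear f -> linear (fun F => dx (f F)).
Proof. by move=> hf c F G; rewrite hf dxD dxZ. Qed.
Lemma lin_dtheta i f : linear f -> linear (fun F => dtheta i (f F)).
Proof. by move=> hf c F G; rewrite hf dthetaD dthetaZ. Qed.
Lemma lin_eta i f : linear f -> linear (fun F => eta i (f F)).
Proof. by move=> hf; apply/lin_add/lin_opp/lin_mull/lin_dx => //; apply/lin_dtheta. Qed.
Lemma lin_psign f : linear f -> linear (fun F => psign (f F)).
Proof. by move=> hf c F G; rewrite hf psignD psignZ. Qed.
Lemma scoef_part p F S : scoef (part p F) S = if odd #|S| == p then scoef F S else 0.
Proof. exact: scoefE. Qed.
Lemma lin_part p f : linear f -> linear (fun F => part p (f F)).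
Proof.
move=> hf c F G; rewrite hf; apply/superpolyP => S.
by rewrite scoefD scoefZ !scoef_part scoefD scoefZ; case: ifP; rewrite // scaler0 addr0.
Qed.

End Linear.

(** * Removing parities from the invariance condition *)

Section Invariance.
Set Implicit Arguments.
Unset Strict Implicit.
Variables (R : fieldType) (n : nat).
Local Notation V := (superpoly R n).
Implicit Types (F G H : V) (T A : V -> V -> V) (lambda mu nu : R).

Definition bilinear_op T : Prop :=
  (forall G, linear (fun F => T F G)) /\ (forall F, linear (T F)).

Lemma bidiff_bilinear T : is_bidiff T -> bilinear_op T.
Proof.
case=> ts eT; have lin_word a I (f : V -> V) : linear f ->
    linear (fun F : V => deriv_word a I (f F)).
  move=> hf; rewrite /deriv_word.
  have {}hf : linear (fun F => foldr (@dtheta R n) (f F) I).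
    by elim: I => //= i I IH; apply: lin_dtheta.
  by elim: a => //= a IH; apply: lin_dx.
split=> F c G G'; rewrite !eT scaler_sumr -big_split /=; apply: eq_bigr => t _.
  rewrite /bidiff_eval; move: c G G'; apply/lin_mulr/lin_mull/lin_word.
  by case: (bt_sign t) => //; apply: lin_psign.
by rewrite /bidiff_eval; move: c G G'; apply/lin_mull/lin_word.
Qed.

Lemma lin_lie lambda H : linear (lie lambda H).
Proof.
rewrite /lie /contact_field; apply: lin_add; last exact/lin_scale/lin_mull.
apply: lin_add; first exact/lin_mull/lin_dx.
apply/lin_opp/lin_scale/lin_sum => i; exact/lin_mull/lin_eta.
Qed.

Lemma lie0l lambda G : lie lambda 0 G = 0.
Proof.
rewrite /lie /contact_field dx0 !mul0r scaler0 addr0 sub0r psign0.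
by rewrite big1 ?scaler0 ?oppr0 // => i _; rewrite /eta dtheta0 dx0 mulr0 subr0 mul0r.
Qed.

Section Bilinear.
Variable T : V -> V -> V.
Hypothesis bT : bilinear_op T.
Let lT G : linear (fun F => T F G) := proj1 bT G.
Let rT F : linear (T F) := proj2 bT F.

Lemma bil_op_part a : bilinear_op (op_part a T).
Proof.
rewrite /op_part; split=> F; do 2!apply: lin_sum => ?; apply: lin_part.
  by apply: (lin_comp (lT _)); apply: lin_part.
by apply: (lin_comp (rT _)); apply: lin_part.
Qed.

Lemma op_part_sum F G : op_part true T F G + op_part false T F G = T F G.
Proof.
rewrite -{3}(part_sum F) -{3}(part_sum G) (linD _ _ (lT _)) !(linD _ _ (rT _)).
rewrite /op_part !big_bool /=; apply/superpolyP => S; rewrite !scoefD.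
have e (X : V) : scoef X S = scoef (part false X) S + scoef (part true X) S.
  by rewrite -scoefD part_sum.
rewrite (e (T (part false F) (part false G))) (e (T (part true F) (part false G))).
rewrite (e (T (part false F) (part true G))) (e (T (part true F) (part true G))).
ring.
Qed.

(** Conjugation by the parity involution acts on an operator of parity [a] as [(-1)^a]; this
    expresses the alternating sum of the components through [T] alone. *)
Lemma op_part_alt F G :
  op_part false T F G - op_part true T F G = psign (T (psign F) (psign G)).
Proof.
rewrite {2 3}/psign (linD _ _ (lT _)) !(linD _ _ (rT _)) !(linN _ (lT _)) !(linN _ (rT _)).
rewrite /op_part !big_bool /=; apply/superpolyP => S.
rewrite /psign !(linD _ _ (lin_part _ (@lin_id R n))) !(linN _ (lin_part _ (@lin_id R n))).
rewrite !(scoefD, scoefN); ring.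
Qed.

End Bilinear.

Section Equivariance.
Variables (lambda mu nu : R) (T : V -> V -> V).
Hypothesis bT : bilinear_op T.
Hypothesis iT : contact_invariant lambda mu nu T.

Let lA a G : linear (fun F => op_part a T F G) := proj1 (bil_op_part bT a) G.
Let rA a F : linear (op_part a T F) := proj2 (bil_op_part bT a) F.

Lemma hom_action0 a h f F G : hom_action lambda mu nu a h f 0 (op_part a T) F G = 0.
Proof.
rewrite /hom_action !lie0l (lin0 (lA _ _)) (lin0 (rA _ _)).
by rewrite scaler0 addr0 scaler0 subr0.
Qed.

Lemma contact_action_homogeneous h H F G : homogeneous h H ->
  contact_action lambda mu nu H T F G =
  \sum_a \sum_f hom_action lambda mu nu a h f H (op_part a T) (part f F) G.
Proof.
move=> hH; rewrite /contact_action; apply: eq_bigr => a _.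
rewrite (bigD1 h) //= [X in _ + X]big1 ?addr0 => [|b /negPf nb].
  by apply: eq_bigr => f _; rewrite (part_homogeneous h hH) eqxx.
by rewrite big1 // => f _; rewrite (part_homogeneous b hH) nb hom_action0.
Qed.

Let lie_split a H F G : lie nu H (op_part a T F G) =
  lie nu H (op_part a T (part true F) G) + lie nu H (op_part a T (part false F) G).
Proof. by rewrite -(linD _ _ (lin_lie _ _)) -(linD _ _ (lA _ _)) addrC part_sum. Qed.

Let lieL_split a H F G : op_part a T (lie lambda H F) G =
  op_part a T (lie lambda H (part true F)) G + op_part a T (lie lambda H (part false F)) G.
Proof. by rewrite -(linD _ _ (lA _ _)) -(linD _ _ (lin_lie _ _)) addrC part_sum. Qed.

Let arg_split a F G :
  op_part a T F G = op_part a T (part true F) G + op_part a T (part false F) G.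
Proof. by rewrite -(linD _ _ (lA _ _)) addrC part_sum. Qed.

(** All signs in [hom_action] are 1 for even [H], so the sum over the parities of operator and
    argument reassembles [T]. *)
Lemma even_equivariant H F G : homogeneous false H ->
  lie nu H (T F G) = T (lie lambda H F) G + T F (lie mu H G).
Proof.
move=> hH; have := iT H F G; rewrite (contact_action_homogeneous _ _ hH).
rewrite big_bool !(big_bool _ (fun f => hom_action _ _ _ _ _ f _ _ _ _)).
rewrite /hom_action !andbF !expr0 !scale1r => h.
rewrite -!(op_part_sum bT) (linD _ _ (lin_lie _ _)).
rewrite !(lie_split _ H F) !(lieL_split _ H F) !(arg_split _ F (lie mu H G)).
apply: subr0_eq; rewrite -[RHS]h.
do 4!move: (lie nu H _) => ?; do 8!move: (op_part _ T _ _) => ?.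
by apply/superpolyP => S; rewrite !(scoefD, scoefN); ring.
Qed.

(** For odd [H] the sign of the operator is removed by [op_part_alt]. The sign of [F] turns [F] into
    [psign F] in the second term, and the conjugation there turns it back into [F]. *)
Lemma odd_equivariant H F G : homogeneous true H ->
  lie nu H (T F G) =
    psign (T (psign (lie lambda H F)) (psign G) + T F (psign (lie mu H G))).
Proof.
move=> hH; have := iT H F G; rewrite (contact_action_homogeneous _ _ hH).
rewrite big_bool !(big_bool _ (fun f => hom_action _ _ _ _ _ f _ _ _ _)).
rewrite /hom_action !andbT !expr0 !expr1 !scale1r !scaleN1r => h.
rewrite psignD -(op_part_alt bT) -[X in T X (psign _)]psignK -(op_part_alt bT).
rewrite -(op_part_sum bT) (linD _ _ (lin_lie _ _)).
rewrite !(lie_split _ H F) !(lieL_split _ H F) /psign.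
rewrite !(linD (part false F) _ (lA _ _)) !(linN (part true F) (lA _ _)).
apply: subr0_eq; rewrite -[RHS]h.
do 4!move: (lie nu H _) => ?; do 8!move: (op_part _ T _ _) => ?.
by apply/superpolyP => S; rewrite !(scoefD, scoefN); ring.
Qed.

End Equivariance.
End Invariance.

(** * Values at the origin *)

Section WordAction.
Set Implicit Arguments.
Unset Strict Implicit.
Variables (R : fieldType) (n : nat).
Hypothesis two_neq0 : 2%:R != 0 :> R.
Local Notation V := (superpoly R n).
Local Notation w := (wmon R).
Implicit Types (F G H : V) (i j k l : 'I_n) (lambda : R) (s t : seq 'I_n).

Lemma cstX_dx_wmon a s : cst n 'X * dx (w a s) = a%:R *: w a s.
Proof.
rewrite dx_wmon -scalerAr wmonS.
by case: a => [|a] //=; rewrite !scale0r.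
Qed.

Lemma lie2_x_wmon lambda a s : lie2 lambda (w 1 [::]) (w a s) =
  ((a.*2 + size s)%:R + 2%:R * lambda) *: w a s.
Proof.
rewrite lie2_x // cstX_dx_wmon euler_wmon scalerA -!scalerDl addrA; congr (_ *: _).
by rewrite -muln2 natrD natrM mulrC.
Qed.

(** In this table each letter of the field is either absent from the word or stands at its front;
    later arguments are arranged so that no other position occurs. *)
Lemma lie2_xtheta_notin lambda a i s : i \notin s ->
  lie2 lambda (w 1 [:: i]) (w a s) = ((a + size s)%:R + 2%:R * lambda) *: w a (i :: s).
Proof.
move=> nis; rewrite lie2_xtheta // dtheta_wmon // mulr0 addr0 cstX_dx_wmon euler_wmon.
by rewrite -!scalerDl -scalerAr -wmon_cons natrD addrA.
Qed.

Lemma lie2_xtheta_head lambda a i s : i \notin s ->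
  lie2 lambda (w 1 [:: i]) (w a (i :: s)) = w a.+1 s.
Proof.
move=> nis; rewrite lie2_xtheta // dtheta_wmon_head // wmonS cstX_dx_wmon euler_wmon.
by rewrite -!scalerDl -scalerAr [w a (i :: s)]wmon_cons thetaK scaler0 add0r.
Qed.

Lemma lie2_rot_notin lambda a i j s : i \notin s -> j \notin s ->
  lie2 lambda (w 0 [:: i; j]) (w a s) = 0.
Proof. by move=> nis njs; rewrite lie2_rot // !dtheta_wmon // !mulr0 subrr. Qed.

Lemma dtheta_wmon_cons a i j s : i != j -> i \notin s -> dtheta i (w a (j :: s)) = 0.
Proof. by move=> nij nis; rewrite dtheta_wmon // inE negb_or nij. Qed.

Lemma dtheta_wmon_second a i j s : i != j -> j \notin s ->
  dtheta j (w a (i :: j :: s)) = - w a (i :: s).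
Proof.
move=> nij njs; rewrite wmon_cons dtheta_thetaM eq_sym (negPf nij) sub0r.
by rewrite dtheta_wmon_head // -wmon_cons.
Qed.

Lemma lie2_rot_fst lambda a i j s : i != j -> i \notin s -> j \notin s ->
  lie2 lambda (w 0 [:: i; j]) (w a (i :: s)) = - w a (j :: s).
Proof.
move=> nij nis njs; rewrite lie2_rot // dtheta_wmon_cons // 1?eq_sym //.
by rewrite dtheta_wmon_head // mulr0 sub0r -wmon_cons.
Qed.

Lemma lie2_rot_snd lambda a i j s : i != j -> i \notin s -> j \notin s ->
  lie2 lambda (w 0 [:: i; j]) (w a (j :: s)) = w a (i :: s).
Proof.
move=> nij nis njs; rewrite lie2_rot // dtheta_wmon_head // dtheta_wmon_cons //.
by rewrite mulr0 subr0 -wmon_cons.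
Qed.

Lemma lie2_rot_both lambda a i j s : i != j -> i \notin s -> j \notin s ->
  lie2 lambda (w 0 [:: i; j]) (w a (i :: j :: s)) = 0.
Proof.
move=> nij nis njs; rewrite lie2_rot // dtheta_wmon_second // dtheta_wmon_head.
  by rewrite !wmon_cons mulrN !thetaK !oppr0 addr0.
by rewrite inE negb_or nij.
Qed.

Lemma lie2_xrot_notin lambda a i j s : i \notin s -> j \notin s ->
  lie2 lambda (w 1 [:: i; j]) (w a s) =
  ((size s)%:R + 2%:R * lambda) *: w a (i :: j :: s).
Proof.
move=> nis njs; rewrite lie2_xrot // !dtheta_wmon // !mulr0 subrr mulr0 subr0.
by rewrite euler_wmon -scalerDl -!scalerAr -!wmon_cons.
Qed.

Lemma wmon_swap a i j s : w a (i :: j :: s) = - w a (j :: i :: s).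
Proof. by rewrite !wmon_cons theta_swap. Qed.

Lemma lie2_xrot_fst lambda a i j s : i != j -> i \notin s -> j \notin s ->
  lie2 lambda (w 1 [:: i; j]) (w a (i :: s)) = - w a.+1 (j :: s).
Proof.
move=> nij nis njs; rewrite lie2_xrot // dtheta_wmon_head // dtheta_wmon_cons // 1?eq_sym //.
rewrite euler_wmon -scalerDl -!scalerAr [w a (i :: s)]wmon_cons theta_swap thetaK.
by rewrite mulr0 oppr0 scaler0 mulr0 subr0 sub0r -wmon_cons wmonS.
Qed.

Lemma lie2_xrot_snd lambda a i j s : i != j -> i \notin s -> j \notin s ->
  lie2 lambda (w 1 [:: i; j]) (w a (j :: s)) = w a.+1 (i :: s).
Proof.
move=> nij nis njs; rewrite lie2_xrot // dtheta_wmon_head // dtheta_wmon_cons //.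
rewrite euler_wmon -scalerDl -!scalerAr [w a (j :: s)]wmon_cons thetaK.
by rewrite !mulr0 scaler0 !sub0r mulrN opprK -wmon_cons wmonS.
Qed.

Lemma lie2_xrot_both lambda a i j s : i != j -> i \notin s -> j \notin s ->
  lie2 lambda (w 1 [:: i; j]) (w a (i :: j :: s)) = 0.
Proof.
move=> nij nis njs; rewrite lie2_xrot // dtheta_wmon_second // dtheta_wmon_head.
  rewrite mulrN [w a (j :: s)]wmon_cons [w a (i :: s)]wmon_cons !thetaK !oppr0 addr0 mulr0 oppr0 addr0.
  rewrite euler_wmon -scalerDl -!scalerAr [w a (i :: j :: s)]wmon_cons theta_swap thetaK.
  by rewrite mulr0 oppr0 scaler0.
by rewrite inE negb_or nij.
Qed.

(** Only the term with [dtheta i] survives: [j] and [k] do not occur in the word, and the [dx] term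
    would contain [theta R i] twice. *)
Lemma lie2_cubic_fst lambda a i j k s : i != j -> i != k ->
  i \notin s -> j \notin s -> k \notin s ->
  lie2 lambda (w 0 [:: i; j; k]) (w a (i :: s)) = w a (j :: k :: s).
Proof.
move=> nij nik nis njs nks; rewrite lie2_cubic // dtheta_wmon_head //.
rewrite !dtheta_wmon_cons 1?eq_sym // !mulr0 subrr subr0 dx_wmon -!scalerAr.
rewrite [w a.-1 (i :: s)]wmon_cons (theta_swap k i) !mulrN (theta_swap j i) !mulrN.
by rewrite thetaK !oppr0 scaler0 oppr0 add0r -!wmon_cons.
Qed.

End WordAction.

Section Origin.
Set Implicit Arguments.
Unset Strict Implicit.
Variables (R : comNzRingType) (n : nat).
Local Notation V := (superpoly R n).
Implicit Types (F G : V) (i j : 'I_n).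

Definition ev0 F : R := (scoef F set0)`_0.

Lemma ev0D F G : ev0 (F + G) = ev0 F + ev0 G.
Proof. by rewrite /ev0 scoefD coefD. Qed.
Lemma ev0N F : ev0 (- F) = - ev0 F.
Proof. by rewrite /ev0 scoefN coefN. Qed.
Lemma ev0Z (c : R) F : ev0 (c *: F) = c * ev0 F.
Proof. by rewrite /ev0 scoefZ coefZ. Qed.
Lemma ev00 : ev0 0 = 0.
Proof. by rewrite /ev0 scoef0 coef0. Qed.
Lemma ev0_psign F : ev0 (psign F) = ev0 F.
Proof. by rewrite /ev0 scoef_psign cards0 mul1r. Qed.
(** Evaluation at the origin is multiplicative, so a field whose coefficients lie in the ideal of
    [x] and the odd variables contributes nothing on the target side, apart from the weight term of
    [x] itself. *)
Lemma ev0M F G : ev0 (F * G) = ev0 F * ev0 G.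
Proof.
rewrite /ev0 scoefM (bigD1 set0) //= setD0 ninv0l mul1r big1 ?addr0 ?coef0M //.
by move=> S /andP[]; rewrite subset0 => ->.
Qed.
Lemma ev0_theta i : ev0 (theta R i) = 0.
Proof.
rewrite /ev0 scoef_theta; case: eqP => [/setP/(_ i)|_]; last by rewrite coef0.
by rewrite !inE eqxx.
Qed.
Lemma ev0_cstX : ev0 (cst n 'X) = 0.
Proof. by rewrite /ev0 scoefE eqxx coefX. Qed.

End Origin.

Section OriginEquivariance.
Set Implicit Arguments.
Unset Strict Implicit.
Variables (R : fieldType) (n : nat).
Hypothesis two_neq0 : 2%:R != 0 :> R.
Local Notation V := (superpoly R n).
Implicit Types (F G H : V) (i j : 'I_n).

Lemma ev0_lie2_x nu F : ev0 (lie2 nu (wmon R 1 [::]) F) = 2%:R * nu * ev0 F.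
Proof.
rewrite lie2_x // !ev0D !ev0Z ev0M ev0_cstX mul0r mulr0 add0r.
by rewrite /euler (big_morph _ (@ev0D R n) (@ev00 R n)) big1 ?add0r // => l _; rewrite ev0M ev0_theta mul0r.
Qed.

Lemma ev0_lie2_xtheta nu i F : ev0 (lie2 nu (wmon R 1 [:: i]) F) = 0.
Proof. by rewrite lie2_xtheta // ev0D !ev0M ev0_theta ev0_cstX !mul0r addr0. Qed.
Lemma ev0_lie2_rot nu i j F : ev0 (lie2 nu (wmon R 0 [:: i; j]) F) = 0.
Proof. by rewrite lie2_rot // ev0D ev0N !ev0M !ev0_theta !mul0r subr0. Qed.
Lemma ev0_lie2_xrot nu i j F : ev0 (lie2 nu (wmon R 1 [:: i; j]) F) = 0.
Proof. by rewrite lie2_xrot // ev0D ev0N !ev0M !ev0_theta ev0_cstX !mul0r subr0. Qed.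
Lemma ev0_lie2_cubic nu i j k F : ev0 (lie2 nu (wmon R 0 [:: i; j; k]) F) = 0.
Proof.
by rewrite lie2_cubic // !(ev0D, ev0N) !ev0M !ev0_theta !mul0r !(oppr0, addr0).
Qed.

Lemma homogeneous_psign (p : bool) F : psign F = (-1) ^+ p *: F -> homogeneous p F.
Proof.
move=> /superpolyP e S nz; have := e S; rewrite scoef_psign scoefZ -signr_odd.
have /eqP e2 : scoef F S + scoef F S != 0.
  by rewrite -mulr2n -scaler_nat scaler_eq0 negb_or two_neq0.
case: (odd #|S|) p {e} => [] [] //=; rewrite ?expr1 ?expr0 => h; case: e2.
  by rewrite -{1}[scoef F S]scale1r -h mulN1r addNr.
by rewrite -{1}[scoef F S]mul1r h scaleN1r addNr.
Qed.

Lemma homogeneous_wmon a s : homogeneous (odd (size s)) (wmon R (n := n) a s).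
Proof. by apply: homogeneous_psign; rewrite psign_wmon signr_odd. Qed.

Lemma eta_psign i F : eta i (psign F) = - psign (eta i F).
Proof.
rewrite /eta dtheta_psign dx_psign psignD psignN psignM psign_theta.
by rewrite mulNr opprK [RHS]opprD.
Qed.

(** The action of an odd field reverses parity, hence anticommutes with the parity involution. *)
Lemma psign_lie lambda H F : psign H = - H ->
  psign (lie lambda H F) = - lie lambda H (psign F).
Proof.
move=> eH.
have e1 : psign (H * dx F) = - (H * dx (psign F)) by rewrite psignM eH dx_psign mulNr.
have e3 : psign (dx H * F) = - (dx H * psign F) by rewrite psignM -dx_psign eH dxN mulNr.
have e2 : psign (\sum_(i < n) eta i (psign H) * eta i F) =
    - \sum_(i < n) eta i (psign H) * eta i (psign F).
  rewrite (big_morph _ (@psignD R n) (@psign0 R n)) -sumrN; apply: eq_bigr => i _.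
  rewrite psignM [eta i (psign F)]eta_psign mulrN opprK; congr (_ * _).
  by rewrite -[LHS]opprK -eta_psign psignK -{1}[H]opprK -eH (linN _ (lin_eta i (@lin_id R n))) opprK.
rewrite /lie /contact_field psignD psignD psignN !psignZ e1 e2 e3 !scalerN.
by rewrite [RHS]opprD [in RHS]opprD.
Qed.

Variables (lambda mu nu : R) (T : V -> V -> V).
Hypothesis bT : bilinear_op T.
Hypothesis iT : contact_invariant lambda mu nu T.

Definition phi F G := ev0 (T F G).

Lemma phiZl c F G : phi (c *: F) G = c * phi F G.
Proof. by rewrite /phi (linZ _ _ (proj1 bT G)) ev0Z. Qed.
Lemma phiZr c F G : phi F (c *: G) = c * phi F G.
Proof. by rewrite /phi (linZ _ _ (proj2 bT F)) ev0Z. Qed.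
Lemma phiNl F G : phi (- F) G = - phi F G.
Proof. by rewrite -scaleN1r phiZl mulN1r. Qed.
Lemma phiNr F G : phi F (- G) = - phi F G.
Proof. by rewrite -scaleN1r phiZr mulN1r. Qed.
Lemma phi0l G : phi 0 G = 0.
Proof. by have := phiZl 0 0 G; rewrite scale0r mul0r. Qed.
Lemma phi0r F : phi F 0 = 0.
Proof. by have := phiZr 0 F 0; rewrite scale0r mul0r. Qed.

Lemma even_origin c s F G : ~~ odd (size s) ->
  phi (lie2 lambda (wmon R c s) F) G + phi F (lie2 mu (wmon R c s) G) =
  ev0 (lie2 nu (wmon R c s) (T F G)).
Proof.
move=> es; rewrite /lie2 phiZl phiZr ev0Z -mulrDr -ev0D; congr (_ * ev0 _).
by rewrite (even_equivariant bT iT) //; move: (@homogeneous_wmon c s); rewrite (negPf es).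
Qed.

Lemma odd_origin c s F G : odd (size s) ->
  (forall H, ev0 (lie2 nu (wmon R c s) H) = 0) ->
  phi (lie2 lambda (wmon R c s) F) G + phi (psign F) (lie2 mu (wmon R c s) G) = 0.
Proof.
(* With [psign F] and [psign G] as arguments, the inner involutions of [odd_equivariant] cancel
   after [psign_lie], up to a common sign. *)
move=> os /(_ (T (psign F) (psign G))).
have hH : homogeneous true (wmon R (n := n) c s) by move: (@homogeneous_wmon c s); rewrite os.
have eH : psign (wmon R (n := n) c s) = - wmon R c s by rewrite psign_wmon -signr_odd os scaleN1r.
rewrite /lie2 ev0Z (odd_equivariant bT iT _ _ hH) ev0_psign !(psign_lie _ _ eH) !psignK.
rewrite ev0D -/(phi _ _) -/(phi _ _) phiNl phiNr phiZl phiZr => /eqP.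
by rewrite -opprD mulrN oppr_eq0 mulrDr => /eqP.
Qed.

End OriginEquivariance.

(** * The singular values of an invariant operator *)

Section LinearSystems.
Set Implicit Arguments.
Unset Strict Implicit.
Variable R : realFieldType.
Implicit Types (A B L U : R).

(** Here [f p] is the value on the two halves of a full word cut after [p] letters, [A] and [B] are
    the exponents of [x], and [L], [U] are twice the weights. The three families of equations come
    from [x theta_i], [x theta_i theta_j] and the cubic fields. The last makes [f] constant strictly
    inside, which leaves three unknowns. *)
Lemma linear_chain_ge3 (n : nat) A B L U (f : nat -> R) :
  (2 < n)%N -> 0 <= A -> 0 <= B ->
  (forall p q, (p + q).+1 = n ->
     (A + p%:R + L) * f p.+1 + (B + q%:R + U) * f p = 0) ->
  (forall p q, (p + q).+2 = n -> (p%:R + L) * f p.+2 + (q%:R + U) * f p = 0) ->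
  (forall p q, (p + q).+3 = n -> f p.+1 = f p.+2) ->
  forall p, (p <= n)%N -> f p = 0.
Proof.
move=> n3 A0 B0 h2 h3 h6.
case: n n3 h2 h3 h6 => [|[|[|m]]] // _ h2 h3 h6.
have fM p : (p <= m.+1)%N -> f p.+1 = f 1%N.
  elim: p => // p IH lpm; rewrite -(IH (ltnW lpm)).
  by rewrite (h6 p (m - p)%N) // subnKC.
have := h2 0%N m.+2 (erefl _); have := h3 0%N m.+1 (erefl _).
have := h2 m.+2 0%N; rewrite addn0 => /(_ (erefl _)).
have := h3 m.+1 0%N; rewrite addn0 => /(_ (erefl _)).
have := h2 1%N m.+1 (erefl _); rewrite (fM m.+1) // (fM m) // (fM 1%N) // -!natr1.
have m0 : 0 <= m%:R :> R by rewrite ler0n.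
set M := f 1%N; set D0 := f 0%N; set Dn := f m.+3; set k := m%:R in m0 *.
move=> e5 e4 e3 e2 e1.
(* At either end the equations of [x theta_i] and [x theta_i theta_j] have the same part in [L] and
   [U], so their difference is free of the weights. *)
have d1 : A * M + (B + 1) * D0 = 0 by lra.
have d2 : (A + 1) * Dn + B * M = 0 by lra.
have r1 : (L * (B + 1) - (k + 1 + U) * A) * M = 0.
  have -> : (L * (B + 1) - (k + 1 + U) * A) * M =
    (B + 1) * ((0 + L) * M + (k + 1 + U) * D0) - (k + 1 + U) * (A * M + (B + 1) * D0) by ring.
  by rewrite d1 e2 !mulr0 subr0.
have r2 : (U * (A + 1) - (k + 1 + L) * B) * M = 0.
  have -> : (U * (A + 1) - (k + 1 + L) * B) * M =
    (A + 1) * ((k + 1 + L) * Dn + (0 + U) * M) - (k + 1 + L) * ((A + 1) * Dn + B * M) by ring.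
  by rewrite d2 e4 !mulr0 subr0.
(* This is [e5 - r1 - r2]: the interior equation [e5] contains [L + U], and so does the sum of [r1]
   and [r2], so the weights cancel. *)
have r3 : ((A + B + 1) * (k + 1 + 1)) * M = 0 by lra.
have M0 : M = 0.
  move/eqP: r3; rewrite mulf_eq0 => /orP[|/eqP //].
  by rewrite mulf_eq0 => /orP[] /eqP; lra.
have D00 : D0 = 0.
  by move/eqP: d1; rewrite M0 mulr0 add0r mulf_eq0 => /orP[/eqP|/eqP //]; lra.
have Dn0 : Dn = 0.
  by move/eqP: d2; rewrite M0 mulr0 addr0 mulf_eq0 => /orP[/eqP|/eqP //]; lra.
case=> [//|p]; rewrite ltnS leq_eqVlt => /orP[/eqP -> //|lp].
by rewrite fM.
Qed.

(** With two letters there is no cubic field; instead a factor [x] is traded between the arguments,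
    which relates different [a], [b]. For fixed [a + b > 0] this leaves three values: the middle one
    and the two extreme ones. *)
Lemma linear_chain2 L U (f : nat -> nat -> nat -> R) :
  (forall a b p, (p < 2)%N -> f a.+1 b p = f a b.+1 p.+1) ->
  (forall a b, f a.+1 b 1%N = f a b.+1 1%N) ->
  (forall a b p q, (p + q)%N = 1%N ->
     (a%:R + p%:R + L) * f a b p.+1 + (b%:R + q%:R + U) * f a b p = 0) ->
  (forall a b, L * f a b 2%N + U * f a b 0%N = 0) ->
  forall a b p, (0 < a + b)%N -> (p <= 2)%N -> f a b p = 0.
Proof.
move=> h1 h4 h2 h3.
have f1 a b : f a b 1%N = f 0%N (a + b)%N 1%N.
  by elim: a b => // a IH b; rewrite h4 IH addnS.
have f0 a b : f a.+1 b 0%N = f 0%N (a.+1 + b)%N 1%N by rewrite h1 // f1 addnS.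
have f2 a b : f a b.+1 2%N = f 0%N (a + b.+1)%N 1%N by rewrite -h1 // f1 addnS.
have key N : [/\ f 0%N N.+1 1%N = 0, f N.+1 0%N 2%N = 0 & f 0%N N.+1 0%N = 0].
  have := h3 N.+1 0%N; have := h2 N.+1 0%N 1%N 0%N (erefl _).
  have := h3 0%N N.+1; have := h2 0%N N.+1 0%N 1%N (erefl _).
  have := h2 N.+1 0%N 0%N 1%N (erefl _).
  rewrite f0 f2 (f1 N.+1) addn0 add0n -!natr1.
  have N0 : 0 <= N%:R :> R by rewrite ler0n.
  move: (f _ _ 1%N) (f _ _ 2%N) (f _ _ 0%N) => m w u e1 e2 e3 e4 e5.
  (* Two of the equations share the terms [L * w + U * m], two others [L * m + U * u]; subtracting
     isolates [w] and [u]. Then [L * m] and [U * m] vanish, and the fifth equation gives [m]. *)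
  have w0 : w = 0.
    have : (N%:R + 1 + 1) * w = 0 by lra.
    by move/eqP; rewrite mulf_eq0 => /orP[/eqP|/eqP //]; lra.
  have u0 : u = 0.
    have : (N%:R + 1 + 1) * u = 0 by lra.
    by move/eqP; rewrite mulf_eq0 => /orP[/eqP|/eqP //]; lra.
  split=> //; subst w u; have : (N%:R + 1 + 1) * m = 0 by lra.
  by move/eqP; rewrite mulf_eq0 => /orP[/eqP|/eqP //]; lra.
move=> a b p ab0; have [N eN] : exists N, (a + b)%N = N.+1 by exists (a + b).-1; rewrite prednK.
have [k1 k2 k0] := key N.
case: p => [|[|[|//]]] _.
- by case: a ab0 eN => [|a] _; [rewrite add0n => -> | rewrite f0 => ->].
- by rewrite f1 eN.
- case: b ab0 eN => [|b] _; last by rewrite f2 => ->.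
  by rewrite addn0 => ->.
Qed.

End LinearSystems.

(** * Linear relations between the values at the origin *)

Section Singular.
Set Implicit Arguments.
Unset Strict Implicit.
Variables (R : realFieldType) (n : nat) (lambda mu nu : R).
Local Notation V := (superpoly R n).
Variable T : V -> V -> V.
Hypothesis bT : bilinear_op T.
Hypothesis iT : contact_invariant lambda mu nu T.
Implicit Types (F G H : V) (i j k l : 'I_n) (s t : seq 'I_n) (S : {set 'I_n}).

Local Notation L := (2%:R * lambda).
Local Notation U := (2%:R * mu).

Let two_neq0 : 2%:R != 0 :> R. Proof. by rewrite pnatr_eq0. Qed.

Definition Phi a s b t : R := phi T (wmon R a s) (wmon R b t).

Lemma Phi_swapl a i j s b t : Phi a (i :: j :: s) b t = - Phi a (j :: i :: s) b t.
Proof. by rewrite /Phi wmon_swap phiNl. Qed.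

Lemma Phi_swapr a s b i j t : Phi a s b (i :: j :: t) = - Phi a s b (j :: i :: t).
Proof. by rewrite /Phi wmon_swap phiNr. Qed.

Lemma Phi_weight a s b t : Phi a s b t != 0 ->
  (a.*2 + size s + (b.*2 + size t))%:R + L + U = 2%:R * nu.
Proof.
move=> nz; have := even_origin two_neq0 bT iT 1 (wmon R a s) (wmon R b t) (isT : ~~ odd (size [::])).
rewrite !lie2_x_wmon // ev0_lie2_x // phiZl // phiZr // -mulrDl => /(mulIf nz) <-.
by rewrite natrD; ring.
Qed.

Let xtheta i F G := odd_origin two_neq0 bT iT F G (isT : odd (size [:: i]))
  (fun H => ev0_lie2_xtheta two_neq0 nu i H).
Let cubic i j k F G := odd_origin two_neq0 bT iT F G (isT : odd (size [:: i; j; k]))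
  (fun H => ev0_lie2_cubic two_neq0 nu i j k H).
Let rot i j F G : phi T (lie2 lambda (wmon R 0 [:: i; j]) F) G +
  phi T F (lie2 mu (wmon R 0 [:: i; j]) G) = 0.
Proof. by rewrite (even_origin two_neq0 bT iT) // ev0_lie2_rot. Qed.
Let xrot i j F G : phi T (lie2 lambda (wmon R 1 [:: i; j]) F) G +
  phi T F (lie2 mu (wmon R 1 [:: i; j]) G) = 0.
Proof. by rewrite (even_origin two_neq0 bT iT) // ev0_lie2_xrot. Qed.

(** The field of [x theta_i] adds the letter [i] where it is absent and trades a leading [i] for a
    factor [x]. This and the next three lemmas are the four combinations for the two arguments. *)
Lemma Phi_xtheta_notin a b i s t : i \notin s -> i \notin t ->
  ((a + size s)%:R + L) * Phi a (i :: s) b t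
  + (-1) ^+ size s * (((b + size t)%:R + U) * Phi a s b (i :: t)) = 0.
Proof.
move=> nis nit; have := xtheta i (wmon R a s) (wmon R b t).
by rewrite !lie2_xtheta_notin // psign_wmon !(phiZl bT, phiZr bT).
Qed.

Lemma Phi_xtheta_both a b i s t : i \notin s -> i \notin t ->
  Phi a.+1 s b (i :: t) - (-1) ^+ size s * Phi a (i :: s) b.+1 t = 0.
Proof.
move=> nis nit; have := xtheta i (wmon R a (i :: s)) (wmon R b (i :: t)).
by rewrite !lie2_xtheta_head // psign_wmon !(phiZl bT, phiZr bT) exprS mulN1r mulNr.
Qed.

Lemma Phi_xtheta_left a b i s t : i \notin s -> i \notin t ->
  Phi a.+1 s b t - (-1) ^+ size s * (((b + size t)%:R + U) * Phi a (i :: s) b (i :: t)) = 0.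
Proof.
move=> nis nit; have := xtheta i (wmon R a (i :: s)) (wmon R b t).
rewrite lie2_xtheta_head // lie2_xtheta_notin // psign_wmon !(phiZl bT, phiZr bT).
by rewrite exprS mulN1r mulNr.
Qed.

Lemma Phi_xtheta_right a b i s t : i \notin s -> i \notin t ->
  ((a + size s)%:R + L) * Phi a (i :: s) b (i :: t) + (-1) ^+ size s * Phi a s b.+1 t = 0.
Proof.
move=> nis nit; have := xtheta i (wmon R a s) (wmon R b (i :: t)).
by rewrite lie2_xtheta_head // lie2_xtheta_notin // psign_wmon !(phiZl bT, phiZr bT).
Qed.

Section Pair.
Variables (i j : 'I_n) (s t : seq 'I_n).
Hypotheses (nij : i != j) (nis : i \notin s) (njs : j \notin s).
Hypotheses (nit : i \notin t) (njt : j \notin t).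

(** A rotation kills words containing both or neither of its letters. If one argument is such a word
    and the other contains just one of the letters, the pair is, up to sign, the image of a pair
    under the rotation. The next three lemmas use the same argument. *)
Lemma Phi_rot_left a b : Phi a (i :: s) b t = 0.
Proof.
have := rot i j (wmon R a (j :: s)) (wmon R b t).
by rewrite lie2_rot_snd // lie2_rot_notin // phi0r // addr0.
Qed.

Lemma Phi_rot_right a b : Phi a s b (i :: t) = 0.
Proof.
have := rot i j (wmon R a s) (wmon R b (j :: t)).
by rewrite lie2_rot_snd // lie2_rot_notin // phi0l // add0r.
Qed.

Lemma Phi_rot_left_both a b : Phi a (i :: j :: s) b (j :: t) = 0.
Proof.
have := rot i j (wmon R a (i :: j :: s)) (wmon R b (i :: t)).
by rewrite lie2_rot_both // lie2_rot_fst // phi0l // add0r phiNr // => /eqP; rewrite oppr_eq0 => /eqP.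
Qed.

Lemma Phi_rot_right_both a b : Phi a (j :: s) b (i :: j :: t) = 0.
Proof.
have := rot i j (wmon R a (i :: s)) (wmon R b (i :: j :: t)).
by rewrite lie2_rot_both // lie2_rot_fst // phi0r // addr0 phiNl // => /eqP; rewrite oppr_eq0 => /eqP.
Qed.

Lemma Phi_rot_cross a b : Phi a (j :: s) b (i :: t) = - Phi a (i :: s) b (j :: t).
Proof.
have := rot i j (wmon R a (i :: s)) (wmon R b (i :: t)).
rewrite !lie2_rot_fst // phiNl // phiNr // => /eqP.
by rewrite subr_eq0 => /eqP h; rewrite /Phi -h opprK.
Qed.

Lemma Phi_rot_diag a b : Phi a (i :: s) b (i :: t) = Phi a (j :: s) b (j :: t).
Proof.
have := rot i j (wmon R a (i :: s)) (wmon R b (j :: t)).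
rewrite lie2_rot_fst // lie2_rot_snd // phiNl // addrC => /eqP.
by rewrite subr_eq0 => /eqP.
Qed.

Lemma Phi_xrot_notin a b : ((size s)%:R + L) * Phi a (i :: j :: s) b t +
  ((size t)%:R + U) * Phi a s b (i :: j :: t) = 0.
Proof.
have := xrot i j (wmon R a s) (wmon R b t).
by rewrite !lie2_xrot_notin // phiZl // phiZr.
Qed.

Lemma Phi_xrot_left a b : ((size s)%:R + L) * Phi a (i :: j :: s) b (i :: j :: t) = 0.
Proof.
have := xrot i j (wmon R a s) (wmon R b (i :: j :: t)).
by rewrite lie2_xrot_both // lie2_xrot_notin // phiZl // phi0r // addr0.
Qed.

Lemma Phi_xrot_right a b : ((size t)%:R + U) * Phi a (i :: j :: s) b (i :: j :: t) = 0.
Proof.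
have := xrot i j (wmon R a (i :: j :: s)) (wmon R b t).
by rewrite lie2_xrot_both // lie2_xrot_notin // phiZr // phi0l // add0r.
Qed.

Lemma Phi_xrot_diag a b : Phi a.+1 (j :: s) b (j :: t) = Phi a (i :: s) b.+1 (i :: t).
Proof.
have := xrot i j (wmon R a (i :: s)) (wmon R b (j :: t)).
rewrite lie2_xrot_fst // lie2_xrot_snd // phiNl // addrC => /eqP.
by rewrite subr_eq0 => /eqP.
Qed.

Lemma Phi_xrot_cross a b : Phi a.+1 (j :: s) b (i :: t) = - Phi a (i :: s) b.+1 (j :: t).
Proof.
have := xrot i j (wmon R a (i :: s)) (wmon R b (i :: t)).
rewrite !lie2_xrot_fst // phiNl // phiNr // => /eqP.
by rewrite subr_eq0 => /eqP h; rewrite /Phi -h opprK.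
Qed.

End Pair.

Lemma Phi_cubic a b i j k s t : i != j -> i != k ->
  i \notin s -> j \notin s -> k \notin s -> i \notin t -> j \notin t -> k \notin t ->
  Phi a (j :: k :: s) b (i :: t) = (-1) ^+ size s * Phi a (i :: s) b (j :: k :: t).
Proof.
move=> nij nik nis njs nks nit njt nkt.
have := cubic i j k (wmon R a (i :: s)) (wmon R b (i :: t)).
rewrite !lie2_cubic_fst // psign_wmon phiZl // exprS mulN1r mulNr => /eqP.
by rewrite subr_eq0 => /eqP.
Qed.

(** If the value [c] is nonzero, [x theta_i theta_j] forces [2 lambda] and [2 mu] both to be
    [- size s]. The two equations of [x theta_i] then have the weight-free coefficients [a + 1] and
    [b + 1], and their other terms agree by the exchange rules for [x] and for the letters;
    eliminating these gives [(a + b + 2) c = 0]. *)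
Lemma Phi_diag_pair a b i j s : i != j -> i \notin s -> j \notin s ->
  Phi a (i :: j :: s) b (i :: j :: s) = 0.
Proof.
move=> nij nis njs; set c := Phi _ _ _ _.
have /eqP := Phi_xrot_left nij nis njs nis njs a b.
rewrite -/c mulf_eq0 => /orP[|/eqP //] /eqP eL.
have /eqP := Phi_xrot_right nij nis njs nis njs a b.
rewrite -/c mulf_eq0 => /orP[|/eqP //] /eqP eU.
have nijs : i \notin j :: s by rewrite inE negb_or nij.
have e1 := Phi_xtheta_right a b nijs nijs.
have e2 := Phi_xtheta_left a b nijs nijs.
have e3 := Phi_rot_diag nij nis njs nis njs a b.+1.
have e4 := Phi_xrot_diag nij nis njs nis njs a b.
move: e1 e2; rewrite e4 e3 -/c /= exprS.
have -> : (a + (size s).+1)%:R + L = a%:R + 1 :> R by move: eL; rewrite !natrD -!natr1; lra.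
have -> : (b + (size s).+1)%:R + U = b%:R + 1 :> R by move: eU; rewrite !natrD -!natr1; lra.
move: (Phi a (j :: s) _ _) => d; rewrite -signr_odd.
have a0 : 0 <= a%:R :> R by rewrite ler0n.
have b0 : 0 <= b%:R :> R by rewrite ler0n.
have {a0 b0} /lt0r_neq0/eqP p0 : 0 < a%:R + b%:R + 2 :> R by lra.
move=> h1 h2; have : (a%:R + b%:R + 2) * c = 0.
  by move: h1 h2; case: odd; rewrite ?expr0 ?expr1; lra.
by move/eqP; rewrite mulf_eq0 => /orP[|] /eqP.
Qed.

Lemma Phi_diag_ge2 a b s : uniq s -> (1 < size s)%N -> Phi a s b s = 0.
Proof.
case: s => [|i [|j s]] //= /and3P[]; rewrite inE negb_or => /andP[nij nis] njs _ _.
exact: Phi_diag_pair.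
Qed.

(** One factor [x] is the price of a new letter [j] in both arguments, so the value is a multiple of
    one with two common letters. *)
Lemma Phi_diag1 a b i j : i != j -> (0 < a + b)%N -> Phi a [:: i] b [:: i] = 0.
Proof.
move=> nij; have hj : j \notin [:: i] by rewrite inE eq_sym.
case: b => [|b]; rewrite ?addn0.
  case: a => // a _; have := Phi_xtheta_left a 0 hj hj.
  by rewrite Phi_diag_pair // 1?eq_sym // !mulr0 subr0.
move=> _; have := Phi_xtheta_right a b hj hj.
by rewrite Phi_diag_pair // 1?eq_sym // mulr0 add0r expr1 mulN1r => /eqP; rewrite oppr_eq0 => /eqP.
Qed.

(** At [a = b = 0], together with its mirror image, this fixes the ratios [2 mu], [- 2 lambda], 1 of
    the values on [(x, 1)], [(1, x)] and [(theta_i, theta_i)]: those of [op_b]. *)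
Lemma Phi_diag0_left a b (i : 'I_n) : Phi a.+1 [::] b [::] = (b%:R + U) * Phi a [:: i] b [:: i].
Proof.
have := Phi_xtheta_left a b (isT : i \notin [::]) (isT : i \notin [::]).
by rewrite expr0 mul1r addn0 => /eqP; rewrite subr_eq0 => /eqP.
Qed.

Lemma Phi_diag0_right a b (i : 'I_n) : Phi a [::] b.+1 [::] = - ((a%:R + L) * Phi a [:: i] b [:: i]).
Proof.
have := Phi_xtheta_right a b (isT : i \notin [::]) (isT : i \notin [::]).
by rewrite expr0 mul1r addn0 addrC => /eqP; rewrite addr_eq0 => /eqP.
Qed.

Lemma Phi_diag0 a b i j : i != j -> (1 < a + b)%N -> Phi a [::] b [::] = 0.
Proof.
move=> nij; case: b => [|b]; rewrite ?addn0.
  by case: a => // a ha; rewrite (Phi_diag0_left a 0 i) (Phi_diag1 nij) ?mulr0 // addn0.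
move=> ab; rewrite (Phi_diag0_right a b i) (Phi_diag1 nij) ?mulr0 ?oppr0 //.
by move: ab; rewrite addnS.
Qed.

(* For a word r = rev s ++ t this is, up to a sign depending only on r, the
   value on x^a theta_(rev s) and x^b theta_t: the sign (-1)^'C(p, 2) undoes the
   reversal of s, so that moving the cut in r produces no sign. *)
Definition cut a s b t : R := (-1) ^+ 'C(size s, 2) * Phi a s b t.

Lemma cut_eq0 a s b t : cut a s b t = 0 -> Phi a s b t = 0.
Proof. by move/eqP; rewrite mulf_eq0 signr_eq0 => /eqP. Qed.

Let cut_cons a i s b t :
  cut a (i :: s) b t = (-1) ^+ 'C(size s, 2) * ((-1) ^+ size s * Phi a (i :: s) b t).
Proof. by rewrite /cut /= binS bin1 exprD -mulrA. Qed.

Let cut_cons2 a i j s b t :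
  cut a (i :: j :: s) b t = - ((-1) ^+ 'C(size s, 2) * Phi a (i :: j :: s) b t).
Proof.
by rewrite cut_cons /= binS bin1 exprD exprS mulN1r mulNr mulrN -mulrA signrMK.
Qed.

Lemma cut_move a b i s t : i \notin s -> i \notin t ->
  (a%:R + (size s)%:R + L) * cut a (i :: s) b t
  + (b%:R + (size t)%:R + U) * cut a s b (i :: t) = 0.
Proof.
move=> nis nit; have := Phi_xtheta_notin a b nis nit; rewrite cut_cons /cut !natrD => h.
rewrite mulrCA [X in _ + X]mulrCA -mulrDr (_ : _ + _ = (-1) ^+ size s *
   ((a%:R + (size s)%:R + L) * Phi a (i :: s) b t
    + (-1) ^+ size s * ((b%:R + (size t)%:R + U) * Phi a s b (i :: t)))).
  by rewrite h !mulr0.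
by rewrite mulrDr signrMK mulrCA.
Qed.

Lemma cut_shift a b i s t : i \notin s -> i \notin t ->
  cut a.+1 s b (i :: t) = cut a (i :: s) b.+1 t.
Proof.
move=> nis nit; have := Phi_xtheta_both a b nis nit; rewrite cut_cons /cut => /eqP.
by rewrite subr_eq0 => /eqP ->.
Qed.

Section CutPair.
Variables (i j : 'I_n) (s t : seq 'I_n).
Hypotheses (nij : i != j) (nis : i \notin s) (njs : j \notin s).
Hypotheses (nit : i \notin t) (njt : j \notin t).

Let nji : j != i. Proof. by rewrite eq_sym. Qed.

Lemma cut_move2 a b : ((size s)%:R + L) * cut a (j :: i :: s) b t
  + ((size t)%:R + U) * cut a s b (i :: j :: t) = 0.
Proof.
have := Phi_xrot_notin njs nis njt nit a b.
rewrite [Phi a s b _]Phi_swapr cut_cons2 /cut => h.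
rewrite -[RHS](mulr0 (- (-1) ^+ 'C(size s, 2))) -h.
by move: (Phi _ _ _ t) (Phi _ _ _ (_ :: _)) (_ ^+ _) => x y z; ring.
Qed.

Lemma cut_shift_in a b :
  cut a.+1 (i :: s) b (j :: t) = cut a (i :: s) b.+1 (j :: t).
Proof.
rewrite /cut (Phi_xrot_cross nji njs nis njt nit) (Phi_rot_cross nij nis njs nit njt).
by rewrite opprK.
Qed.

End CutPair.

(** The cubic field moves a pair of letters from one argument to the other against a single one; an
    exchange of [i] and [k] by a rotation turns this into the passage of [j] alone across the
    cut. *)
Lemma cut_move_in a b i j k s t : uniq [:: i; j; k] -> {in [:: i; j; k], forall l, l \notin s} ->
  {in [:: i; j; k], forall l, l \notin t} ->
  cut a (i :: s) b (j :: k :: t) = cut a (j :: i :: s) b (k :: t).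
Proof.
rewrite /= !inE !negb_or andbT => /andP[/andP[nij nik] njk] hs ht.
have mi : i \in [:: i; j; k] by rewrite !inE eqxx.
have mj : j \in [:: i; j; k] by rewrite !inE eqxx orbT.
have mk : k \in [:: i; j; k] by rewrite !inE eqxx !orbT.
rewrite [RHS]cut_cons /cut; congr (_ * _).
have := Phi_cubic a b nij nik (hs _ mi) (hs _ mj) (hs _ mk) (ht _ mi) (ht _ mj) (ht _ mk).
have nks : k \notin j :: s by rewrite inE negb_or eq_sym njk hs.
have nis : i \notin j :: s by rewrite inE negb_or nij hs.
have nki : i != k by [].
rewrite Phi_swapl (Phi_rot_cross nik nis nks (ht _ mi) (ht _ mk)) opprK.
by rewrite Phi_swapl /= exprS mulN1r mulNr -mulrN => ->; rewrite signrMK.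
Qed.

(** * Complementary supports as cuts of a word in all letters *)

Section CompleteWord.
Variable r : seq 'I_n.
Hypotheses (ur : uniq r) (sr : size r = n).

Let f a b p : R := cut a (rev (take p r)) b (drop p r).

(** The left half is stored reversed, so that the letter crossing the cut is the head of its word
    before and after. *)
Let cut_at p : (p < n)%N -> exists i,
  drop p r = i :: drop p.+1 r /\ rev (take p.+1 r) = i :: rev (take p r).
Proof.
move=> lp; have : (p < size r)%N by rewrite sr.
case: r => // x0 r' lpr; exists (nth x0 (x0 :: r') p).
by rewrite -drop_nth // (take_nth x0) // rev_rcons.
Qed.

Let uniq_cut p : uniq (drop p r ++ rev (take p r)).
Proof.
rewrite (@perm_uniq _ _ r) // -[X in perm_eq _ X](cat_take_drop p r) perm_catC.
by rewrite perm_cat2r perm_rev.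
Qed.

Let size_left p : (p <= n)%N -> size (rev (take p r)) = p.
Proof. by move=> lp; rewrite size_rev size_takel // sr. Qed.

Let f_move a b p q : (p + q).+1 = n ->
  (a%:R + p%:R + L) * f a b p.+1 + (b%:R + q%:R + U) * f a b p = 0.
Proof.
move=> epq; have lp : (p < n)%N by lia.
have [i [e1 e2]] := cut_at lp; have := uniq_cut p; rewrite /f e1 e2 !cat_cons !cons_uniq mem_cat negb_or.
case/andP => /andP[nit nis] _; have := cut_move a b nis nit.
by rewrite size_left ?(ltnW lp) // size_drop sr (_ : n - p.+1 = q)%N //; lia.
Qed.

Let f_move2 a b p q : (p + q).+2 = n ->
  (p%:R + L) * f a b p.+2 + (q%:R + U) * f a b p = 0.
Proof.
move=> epq; have lp : (p < n)%N by lia.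
have lp1 : (p.+1 < n)%N by lia.
have [i [e1 e2]] := cut_at lp; have [j [e3 e4]] := cut_at lp1.
have := uniq_cut p; rewrite /f e4 e2 e1 e3 !cat_cons !cons_uniq !in_cons !mem_cat !negb_or.
case/and3P => /and3P[nij nit nis] /andP[njt njs] _.
have := cut_move2 nis njs nit njt a b.
by rewrite size_left ?(ltnW lp) // size_drop sr (_ : n - p.+2 = q)%N //; lia.
Qed.

Let f_move_in a b p q : (p + q).+3 = n -> f a b p.+1 = f a b p.+2.
Proof.
move=> epq; have lp : (p < n)%N by lia.
have lp1 : (p.+1 < n)%N by lia.
have lp2 : (p.+2 < n)%N by lia.
have [i [e1 e2]] := cut_at lp; have [j [e3 e4]] := cut_at lp1; have [k [e5 e6]] := cut_at lp2.
have := uniq_cut p; rewrite /f e4 e2 e1 e3 e5 !cat_cons !cons_uniq !in_cons !mem_cat !negb_or.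
case/and4P => /and4P[nij nik nit nis] /and3P[njk njt njs] /andP[nkt nks] _.
apply: cut_move_in => [|l|l]; first by rewrite /= !inE negb_or nij nik njk.
  by rewrite !inE => /or3P[] /eqP ->.
by rewrite !inE => /or3P[] /eqP ->.
Qed.

Let f_shift a b p : (p < n)%N -> f a.+1 b p = f a b.+1 p.+1.
Proof.
move=> lp; have [i [e1 e2]] := cut_at lp; have := uniq_cut p.
rewrite /f e1 e2 !cat_cons !cons_uniq mem_cat negb_or => /andP[/andP[nit nis] _].
exact: cut_shift.
Qed.

Let f_shift_in a b p : (p.+1 < n)%N -> f a.+1 b p.+1 = f a b.+1 p.+1.
Proof.
move=> lp1; have lp : (p < n)%N by lia.
have [i [e1 e2]] := cut_at lp; have [j [e3 e4]] := cut_at lp1.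
have := uniq_cut p; rewrite /f e2 e1 e3 !cat_cons !cons_uniq !in_cons !mem_cat !negb_or.
case/and3P => /and3P[nij nit nis] /andP[njt njs] _.
exact: cut_shift_in.
Qed.

Lemma cut_word_eq0 a b p : (2 < n)%N || ((n == 2) && (0 < a + b)%N) -> (p <= n)%N ->
  Phi a (rev (take p r)) b (drop p r) = 0.
Proof.
move=> hn lp; apply: cut_eq0; rewrite -/(f a b p).
case/orP: hn => [n3|/andP[/eqP n2 ab]].
  by apply: (linear_chain_ge3 n3 (ler0n R a) (ler0n R b) (f_move a b) (f_move2 a b) (f_move_in a b)).
move: lp; rewrite n2; apply: (@linear_chain2 R L U f) => //.
- by move=> a' b' p' lp; apply: f_shift; rewrite n2.
- by move=> a' b'; apply: f_shift_in; rewrite n2.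
- by move=> a' b' p' q' e; apply: f_move; rewrite e n2.
by move=> a' b'; have := @f_move2 a' b' 0 0; rewrite n2 !add0r => /(_ (erefl _)).
Qed.

End CompleteWord.

Definition phi_mon a S b S' : R := phi T (mon R a S) (mon R b S').

Lemma phi_mon_words a b s t S S' : uniq s -> uniq t -> s =i S -> t =i S' ->
  Phi a s b t = 0 -> phi_mon a S b S' = 0.
Proof.
move=> us ut eS eS' e; rewrite /phi_mon.
have -> : S = [set x in s] by apply/setP => x; rewrite inE eS.
have -> : S' = [set x in t] by apply/setP => x; rewrite inE eS'.
have [c ->] := mon_wmon R a us; have [d ->] := mon_wmon R b ut.
by rewrite phiZl // phiZr // -/(Phi a s b t) e !mulr0.
Qed.

(** An enumeration of [S] with [i] and [j], when present, in front, as the relations for pairs of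
    letters require. *)
Let word i j S := [seq x <- [:: i; j] | x \in S] ++ enum (S :\ i :\ j).

Let mem_word i j S : word i j S =i S.
Proof.
move=> x; rewrite mem_cat mem_filter mem_enum !inE.
by case: (x == i); case: (x == j); case: (x \in S).
Qed.

Let uniq_word i j S : i != j -> uniq (word i j S).
Proof.
move=> nij; rewrite cat_uniq enum_uniq andbT filter_uniq ?andTb; last by rewrite /= inE nij.
apply/hasPn => x; rewrite mem_enum => xS.
change (x \notin [seq y <- [:: i; j] | y \in S]); rewrite mem_filter !inE.
by move: xS; rewrite !inE => /and3P[/negPf -> /negPf -> _]; rewrite andbF.
Qed.

(** Some [i] lies in exactly one of the two sets, while some [j] lies in both or in neither. So one
    set contains exactly one of [i], [j] and the other both or neither, which is the situation
    killed by the rotation. *)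
Lemma phi_mon_rot a b S S' : S' != S -> S' != ~: S -> phi_mon a S b S' = 0.
Proof.
move=> neS neC.
have [i hi] : exists i, (i \in S') != (i \in S).
  apply/existsP; apply: contraR neS => /existsPn h; apply/eqP/setP => i.
  by have := h i; rewrite negbK => /eqP.
have [j hj] : exists j, (j \in S') == (j \in S).
  apply/existsP; apply: contraR neC => /existsPn h; apply/eqP/setP => j.
  by rewrite inE; have := h j; case: (j \in S); case: (j \in S').
have nij : i != j by apply: contraNneq hi => ->.
have nin X : i \notin enum (X :\ i :\ j) /\ j \notin enum (X :\ i :\ j).
  by rewrite !mem_enum !inE !eqxx !andbF.
have [nis njs] := nin S; have [nit njt] := nin S'.
apply: (phi_mon_words (uniq_word S nij) (uniq_word S' nij)); try exact: mem_word.
move: hi hj; rewrite /word /=; move: (enum _) (enum _) nis njs nit njt => t s.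
case: (i \in S); case: (i \in S'); case: (j \in S); case: (j \in S') => //= nis njs nit njt _ _.
- exact: (Phi_rot_left_both nij).
- exact: (Phi_rot_left nij).
- exact: (Phi_rot_right_both nij).
exact: (Phi_rot_right nij).
Qed.

(** For [n >= 2] the condition leaves out just [n = 2], [a = b = 0], where [op_c], [op_d] and [op_e]
    have their values. *)
Lemma phi_mon_setC a b S : (2 < n)%N || ((n == 2) && (0 < a + b)%N) ->
  phi_mon a S b (~: S) = 0.
Proof.
move=> hn; pose r := enum S ++ enum (~: S).
have ur : uniq r.
  rewrite cat_uniq !enum_uniq andbT /=; apply/hasPn => x.
  by rewrite !mem_enum inE.
have sr : size r = n by rewrite size_cat -!cardE cardsC card_ord.
apply: (@phi_mon_words a b (rev (take #|S| r)) (drop #|S| r)).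
- by rewrite rev_uniq take_uniq.
- exact: drop_uniq.
- by move=> x; rewrite mem_rev /r cardE take_size_cat // mem_enum.
- by move=> x; rewrite /r cardE drop_size_cat // mem_enum.
by apply: cut_word_eq0 => //; rewrite -[X in (_ <= X)%N]card_ord max_card.
Qed.

Lemma phi_mon_diag a b S : (1 < n)%N -> (1 < a + b + #|S|)%N -> phi_mon a S b S = 0.
Proof.
move=> n2 hS; have e : enum S =i S by move=> x; rewrite mem_enum.
apply: (phi_mon_words (enum_uniq _) (enum_uniq _) e e).
have := enum_uniq (mem S); move: hS; rewrite cardE.
have [i [j nij]] : exists i j : 'I_n, i != j.
  by exists (Ordinal (ltnW n2)), (Ordinal n2).
case: (enum _) => [|k [|l s]].
- by rewrite addn0 => hab _; apply: (Phi_diag0 nij).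
- rewrite addn1 ltnS => hab _; have [e1|] := eqVneq k i; last by move/Phi_diag1; apply.
  by rewrite e1; apply: (Phi_diag1 nij).
by move=> _ us; apply: Phi_diag_ge2.
Qed.

Lemma phi_mon_weight a S b S' : phi_mon a S b S' != 0 ->
  (a.*2 + #|S| + (b.*2 + #|S'|))%:R + L + U = 2%:R * nu.
Proof.
have e (X : {set 'I_n}) : enum X =i X by move=> x; rewrite mem_enum.
rewrite !cardE => h; apply: Phi_weight; apply: contraNneq h => h.
exact/eqP/(phi_mon_words (enum_uniq _) (enum_uniq _) (e S) (e S')).
Qed.

End Singular.

(** * Translations *)

Section Translations.
Set Implicit Arguments.
Unset Strict Implicit.
Variables (R : comNzRingType) (n : nat).
Local Notation V := (superpoly R n).
Implicit Types (F G H : V) (i j k l : 'I_n) (T : V -> V -> V) (D E : V -> V).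

(** Twice the action of the field of [theta_i], which does not depend on the weight. *)
Definition xi i F : V := theta R i * dx F + dtheta i F.

Lemma xiM i F G : xi i (F * G) = xi i F * G + psign F * xi i G.
Proof.
have e : theta R i * F = psign F * theta R i by rewrite Mtheta psignK.
rewrite /xi dxM dthetaM (mulrDr (theta R i)) (mulrDl (theta R i * dx F)).
by rewrite (mulrDr (psign F)) !mulrA e addrACA.
Qed.

Lemma lin_xi i : linear (@xi i).
Proof. by apply: lin_add; [apply/lin_mull/lin_dx | apply: lin_dtheta]. Qed.

Lemma xi_psign i F : xi i (psign F) = - psign (xi i F).
Proof.
by rewrite /xi dx_psign dtheta_psign psignD psignM psign_theta mulNr [RHS]opprD opprK.
Qed.

Lemma dx_xi i F : dx (xi i F) = xi i (dx F).
Proof. by rewrite /xi dxD dx_thetaM dx_dtheta. Qed.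

Lemma dx_eta i F : dx (eta i F) = eta i (dx F).
Proof. by rewrite /eta dxD dxN dx_thetaM dx_dtheta. Qed.

(** The fields [eta i] and [xi j] differ in the sign of their [dx] part and supercommute; hence
    expressions in [dx] and [eta] with constant coefficients commute with translations. *)
Lemma eta_xi i j F : eta i (xi j F) = - xi j (eta i F).
Proof.
rewrite /eta /xi !dthetaD dthetaN !dtheta_thetaM !dxD !dxN !dx_thetaM.
rewrite !dx_dtheta (dthetaC i j) eq_sym !mulrDr !mulrN (theta_swap i j).
case: (j == i); apply/superpolyP => S; rewrite !(scoefD, scoefN, scoef0); ring.
Qed.

Lemma eta_anti i j F : i != j -> eta i (eta j F) = - eta j (eta i F).
Proof.
move=> /negPf nij; rewrite /eta !dthetaD !dthetaN !dtheta_thetaM !dxD !dxN !dx_thetaM.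
rewrite !dx_dtheta (dthetaC i j) (eq_sym j) nij !mulrDr !mulrN (theta_swap i j).
apply/superpolyP => S; rewrite !(scoefD, scoefN, scoef0); ring.
Qed.

Definition translation_equivariant T : Prop :=
  (forall F G, dx (T F G) = T (dx F) G + T F (dx G)) /\
  (forall i F G, xi i (T F G) =
     psign (T (psign (xi i F)) (psign G) + T F (psign (xi i G)))).

Lemma transl_add T1 T2 : translation_equivariant T1 -> translation_equivariant T2 ->
  translation_equivariant (fun F G => T1 F G + T2 F G).
Proof.
move=> [d1 x1] [d2 x2]; split=> [F G|i F G].
  by rewrite dxD d1 d2 addrACA.
by rewrite (linD _ _ (@lin_xi i)) x1 x2 -psignD addrACA.
Qed.

Lemma transl_scale (c : R) T : translation_equivariant T ->
  translation_equivariant (fun F G => c *: T F G).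
Proof.
move=> [d1 x1]; split=> [F G|i F G]; first by rewrite dxZ d1 scalerDr.
by rewrite (linZ _ _ (@lin_xi i)) x1 -psignZ scalerDr.
Qed.

Lemma transl_opp T : translation_equivariant T -> translation_equivariant (fun F G => - T F G).
Proof.
move=> [d1 x1]; split=> [F G|i F G]; first by rewrite dxN d1 opprD.
by rewrite (linN _ (@lin_xi i)) x1 -psignN opprD.
Qed.

Lemma transl_sum I (r : seq I) (T : I -> V -> V -> V) :
  (forall m, translation_equivariant (T m)) ->
  translation_equivariant (fun F G => \sum_(m <- r) T m F G).
Proof.
move=> hT; split=> [F G|i F G].
  rewrite (big_morph _ (@dxD R n) (@dx0 R n)) -big_split /=.
  by apply: eq_bigr => k _; rewrite (proj1 (hT k)).
rewrite (big_morph (@xi i) (fun F G => linD F G (@lin_xi i)) (lin0 (@lin_xi i))) -big_split /=.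
rewrite (big_morph _ (@psignD R n) (@psign0 R n)).
by apply: eq_bigr => k _; rewrite (proj2 (hT k)).
Qed.

(** The common parity of [D] and [E] is [e]. When odd, [D] is meant to include a [psign], as in
    [eta i (psign F)]: it then commutes with [xi], while [E] anticommutes. *)
Lemma transl_mul (e : bool) D E : linear D -> linear E ->
  (forall F, dx (D F) = D (dx F)) -> (forall F, dx (E F) = E (dx F)) ->
  (forall i F, D (xi i F) = xi i (D F)) -> (forall i F, E (xi i F) = (-1) ^+ e *: xi i (E F)) ->
  (forall F, D (psign F) = (-1) ^+ e *: psign (D F)) ->
  (forall F, E (psign F) = (-1) ^+ e *: psign (E F)) ->
  translation_equivariant (fun F G => D F * E G).
Proof.
move=> lD lE dD dE xD xE pD pE; split=> [F G|i F G]; first by rewrite dxM dD dE.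
have sK (X : V) : (-1) ^+ e *: ((-1) ^+ e *: X) = X.
  by rewrite scalerA -expr2 -exprM mulnC exprM sqrrN !expr1n scale1r.
rewrite xiM -xD psignD !psignM pD !pE !psignZ !psignK -!scalerAl -!scalerAr sK.
by rewrite xE -scalerAr sK.
Qed.

Let transl_even D E : linear D -> linear E ->
  (forall F, dx (D F) = D (dx F)) -> (forall F, dx (E F) = E (dx F)) ->
  (forall i F, D (xi i F) = xi i (D F)) -> (forall i F, E (xi i F) = xi i (E F)) ->
  (forall F, D (psign F) = psign (D F)) -> (forall F, E (psign F) = psign (E F)) ->
  translation_equivariant (fun F G => D F * E G).
Proof.
move=> lD lE dD dE xD xE pD pE.
by apply: (@transl_mul false) => // *; rewrite expr0 scale1r.
Qed.

Lemma transl_mulop : translation_equivariant (fun F G => F * G).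
Proof. exact: (@transl_even id id). Qed.
Lemma transl_dxl : translation_equivariant (fun F G => dx F * G).
Proof.
apply: (@transl_even (@dx R n) id) => //; first exact/lin_dx/lin_id.
  by move=> i F; rewrite dx_xi.
exact: dx_psign.
Qed.
Lemma transl_dxr : translation_equivariant (fun F G => F * dx G).
Proof.
apply: (@transl_even id (@dx R n)) => //; first exact/lin_dx/lin_id.
  by move=> i F; rewrite dx_xi.
exact: dx_psign.
Qed.

End Translations.

(** * Translation equivariance of the candidates *)

Section EquivariantOperators.
Set Implicit Arguments.
Unset Strict Implicit.
Variables (R : fieldType) (n : nat).
Hypothesis char0 : forall m, m.+1%:R != 0 :> R.
Local Notation V := (superpoly R n).
Implicit Types (F G H : V) (i j k l : 'I_n) (T : V -> V -> V) (D E : V -> V).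

Lemma eta2_psign i j F : eta i (eta j (psign F)) = psign (eta i (eta j F)).
Proof. by rewrite !eta_psign (linN _ (lin_eta i (@lin_id R n))) eta_psign opprK. Qed.
Lemma eta2_xi i j k F : eta i (eta j (xi k F)) = xi k (eta i (eta j F)).
Proof. by rewrite eta_xi (linN _ (lin_eta i (@lin_id R n))) eta_xi opprK. Qed.

Lemma transl_eta2l i j : translation_equivariant (fun F G => eta i (eta j F) * G).
Proof.
apply: (@transl_mul _ _ false (fun F => eta i (eta j F)) id) => //.
- exact/lin_eta/lin_eta/lin_id.
- by move=> F; rewrite !dx_eta.
- by move=> k F; rewrite eta2_xi.
- by move=> k F; rewrite scale1r.
- by move=> F; rewrite scale1r eta2_psign.
by move=> F; rewrite scale1r.
Qed.

Lemma transl_eta2r i j : translation_equivariant (fun F G => F * eta i (eta j G)).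
Proof.
apply: (@transl_mul _ _ false id (fun F => eta i (eta j F))) => //.
- exact/lin_eta/lin_eta/lin_id.
- by move=> F; rewrite !dx_eta.
- by move=> k F; rewrite scale1r eta2_xi.
- by move=> F; rewrite scale1r.
by move=> F; rewrite scale1r eta2_psign.
Qed.

Lemma transl_eta i j : translation_equivariant (fun F G => eta i (psign F) * eta j G).
Proof.
apply: (@transl_mul _ _ true (fun F => eta i (psign F)) (@eta R n j)).
- exact/lin_eta/lin_psign/lin_id.
- exact/lin_eta/lin_id.
- by move=> F; rewrite dx_eta dx_psign.
- by move=> F; rewrite dx_eta.
- move=> k F; rewrite -[psign (xi k F)]opprK -xi_psign.
  by rewrite (linN _ (lin_eta i (@lin_id R n))) eta_xi opprK.
- by move=> k F; rewrite scaleN1r eta_xi.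
- by move=> F; rewrite scaleN1r eta_psign.
by move=> F; rewrite scaleN1r eta_psign.
Qed.

Lemma transl_op_b lambda mu : translation_equivariant (op_b (R := R) (n := n) lambda mu).
Proof.
apply: transl_add; first apply: transl_add.
- exact/transl_scale/transl_dxl.
- exact/transl_opp/transl_scale/transl_dxr.
by apply/transl_opp/transl_scale/transl_sum => i; apply: transl_eta.
Qed.

Lemma transl_eta_wedge i j : translation_equivariant (eta_wedge (R := R) i j).
Proof. by apply/transl_add/transl_opp/transl_eta/transl_eta. Qed.

Lemma bil_mul D E : linear D -> linear E -> bilinear_op (fun F G => D F * E G).
Proof. by move=> lD lE; split=> H; [apply: lin_mulr | apply: lin_mull]. Qed.
Lemma bil_add T1 T2 : bilinear_op T1 -> bilinear_op T2 ->
  bilinear_op (fun F G => T1 F G + T2 F G).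
Proof. by move=> [h1 h2] [h3 h4]; split=> H; apply: lin_add. Qed.
Lemma bil_scale c T : bilinear_op T -> bilinear_op (fun F G => c *: T F G).
Proof. by move=> [h1 h2]; split=> H; apply: lin_scale. Qed.
Lemma bil_opp T : bilinear_op T -> bilinear_op (fun F G => - T F G).
Proof. by move=> [h1 h2]; split=> H; apply: lin_opp. Qed.
Lemma bil_sum I (r : seq I) (T : I -> V -> V -> V) : (forall m, bilinear_op (T m)) ->
  bilinear_op (fun F G => \sum_(m <- r) T m F G).
Proof. by move=> h; split=> H; apply: lin_sum => k; case: (h k). Qed.

Lemma bil_eta i j : bilinear_op (fun F G : V => eta i (psign F) * eta j G).
Proof.
apply: (@bil_mul (fun F => eta i (psign F)) (@eta R n j)).
  exact/lin_eta/lin_psign/lin_id.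
exact/lin_eta/lin_id.
Qed.

Lemma bil_op_b lambda mu : bilinear_op (op_b (R := R) (n := n) lambda mu).
Proof.
apply: bil_add; first apply: bil_add.
- by apply/bil_scale/(@bil_mul (@dx R n) id) => //; apply/lin_dx/lin_id.
- by apply/bil_opp/bil_scale/(@bil_mul id (@dx R n)) => //; apply/lin_dx/lin_id.
by apply/bil_opp/bil_scale/bil_sum => i; apply: bil_eta.
Qed.

Lemma invariant_transl lambda mu nu T : bilinear_op T ->
  contact_invariant lambda mu nu T -> translation_equivariant T.
Proof.
move=> bT iT; have two_neq0 : 2%:R != 0 :> R := char0 1.
have hdx la F : lie la (wmon R 0 [::]) F = dx F.
  by have := lie2_one two_neq0 la F => /(scalerI two_neq0).
have hxi la i F : 2%:R *: lie la (wmon R 0 [:: i]) F = xi i F.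
  exact: (lie2_theta two_neq0 la i F).
split=> [F G|i F G].
  have := even_equivariant bT iT F G (@homogeneous_wmon _ n two_neq0 0 [::]).
  by rewrite !hdx.
have := odd_equivariant bT iT F G (@homogeneous_wmon _ n two_neq0 0 [:: i]).
move/(congr1 (fun X => 2%:R *: X)); rewrite hxi -psignZ scalerDr => ->.
by rewrite -(linZ _ _ (proj1 bT _)) -(linZ _ _ (proj2 bT _)) -!psignZ !hxi.
Qed.

(* Translations move every coefficient of T F G to the origin. *)
Lemma transl_eq0 T : bilinear_op T -> translation_equivariant T ->
  (forall a S b S', ev0 (T (mon R a S) (mon R b S')) = 0) -> forall F G, T F G = 0.
Proof.
move=> bT [dT xT] h0.
have hev F G : ev0 (T F G) = 0.
  elim/(@mon_ind R n): F => [|F1 F2 h1 h2|c F h|a S].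
  - by rewrite (lin0 (proj1 bT G)) ev00.
  - by rewrite (linD _ _ (proj1 bT G)) ev0D h1 h2 addr0.
  - by rewrite (linZ _ _ (proj1 bT G)) ev0Z h mulr0.
  elim/(@mon_ind R n): G => [|F1 F2 h1 h2|c F h|b S'].
  - by rewrite (lin0 (proj2 bT _)) ev00.
  - by rewrite (linD _ _ (proj2 bT _)) ev0D h1 h2 addr0.
  - by rewrite (linZ _ _ (proj2 bT _)) ev0Z h mulr0.
  exact: h0.
have hx F G : scoef (T F G) set0 = 0.
  apply/polyP => a; rewrite coef0; elim: a F G => [|a IH] F G; first exact: hev.
  (* The coefficient of [x^a] in the derivative is [a + 1] times that of [x^(a+1)], and [a + 1] is
     invertible. *)
  have : (scoef (dx (T F G)) set0)`_a = 0 by rewrite dT scoefD coefD !IH addr0.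
  rewrite scoef_dx coef_deriv -mulr_natr => /eqP.
  by rewrite mulf_eq0 (negPf (char0 a)) orbF => /eqP.
move=> F G; apply/superpolyP => S; rewrite scoef0.
have [m] := ubnP #|S|; elim: m S F G => // m IH S F G; rewrite ltnS => leS.
have [->|[i iS]] := set_0Vmem S; first exact: hx.
have lS : (#|S :\ i| < m)%N by move: leS; rewrite (cardsD1 i S) iS.
(* On a set without [i], the part [theta R i * dx] of [xi i] has no coefficient; the part [dtheta i]
   gives, up to sign, the coefficient at [S]. *)
have : scoef (xi i (T F G)) (S :\ i) = 0.
  by rewrite xT scoef_psign scoefD !IH // addr0 mulr0.
rewrite scoefD scoef_thetaM scoef_dtheta setD11 add0r setD1K // => /eqP.
by rewrite mulf_eq0 signr_eq0 => /eqP.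
Qed.

End EquivariantOperators.

(** * Classification *)

Section Values.
Set Implicit Arguments.
Unset Strict Implicit.
Variables (R : realFieldType) (n : nat).
Local Notation V := (superpoly R n).
Implicit Types (F G H : V) (i j k l : 'I_n) (S : {set 'I_n}).

Let char0 m : m.+1%:R != 0 :> R. Proof. by rewrite pnatr_eq0. Qed.

Lemma scoef_mon a S S' : scoef (mon R a S) S' = if S' == S then 'X^a else 0.
Proof. exact: scoefE. Qed.

Lemma ev0_mon a S : ev0 (mon R a S) = ((S == set0) && (a == 0%N))%:R.
Proof.
rewrite /ev0 scoef_mon eq_sym; case: eqP => _ /=; last by rewrite coef0.
by rewrite coefXn eq_sym.
Qed.

Lemma ev0_dx_mon a S : ev0 (dx (mon R a S)) = ((S == set0) && (a == 1%N))%:R.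
Proof.
rewrite /ev0 scoef_dx scoef_mon eq_sym; case: eqP => _ /=; last by rewrite deriv0 coef0.
by rewrite coef_deriv coefXn eq_sym.
Qed.

Lemma ev0_eta i F : ev0 (eta i F) = (scoef F [set i])`_0.
Proof.
rewrite /eta ev0D ev0N ev0M ev0_theta mul0r subr0 /ev0 scoef_dtheta inE setU0.
by rewrite nltE big_set0 mul1r.
Qed.

Lemma ev0_eta_mon i a S : ev0 (eta i (mon R a S)) = ((S == [set i]) && (a == 0%N))%:R.
Proof.
rewrite ev0_eta scoef_mon eq_sym; case: eqP => _ /=; last by rewrite coef0.
by rewrite coefXn eq_sym.
Qed.

Lemma ev0_eta2_mon i j a S : i != j -> (S != [set i; j]) || (a != 0%N) ->
  ev0 (eta j (eta i (mon R a S))) = 0.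
Proof.
move=> nij h; rewrite ev0_eta /eta scoefD scoefN scoef_thetaM.
rewrite inE (negPf nij) subr0 scoef_dtheta inE (negPf nij) scoef_mon.
rewrite coef0M eq_sym; case: eqP h => /= [_ na|_ _]; last by rewrite coef0 mulr0.
by rewrite coefXn eq_sym (negPf na) mulr0.
Qed.

Lemma ev0_eta_psign i F : ev0 (eta i (psign F)) = - ev0 (eta i F).
Proof. by rewrite eta_psign ev0N ev0_psign. Qed.

Lemma ev0_sum_eta F G : ev0 (\sum_(i < n) eta i (psign F) * eta i G) =
  - \sum_(i < n) ev0 (eta i F) * ev0 (eta i G).
Proof.
rewrite (big_morph _ (@ev0D R n) (@ev00 R n)) -sumrN; apply: eq_bigr => i _.
by rewrite ev0M ev0_eta_psign mulNr.
Qed.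

Lemma ev0_op_b lambda mu F G : ev0 (op_b lambda mu F G) =
  mu * (ev0 (dx F) * ev0 G) - lambda * (ev0 F * ev0 (dx G))
  + 2%:R^-1 * \sum_(i < n) ev0 (eta i F) * ev0 (eta i G).
Proof.
rewrite /op_b !(ev0D, ev0N, ev0Z) !ev0M ev0_sum_eta.
by rewrite mulrN opprK.
Qed.

Lemma ev0_op_b_neq lambda mu a S b S' : S' != S ->
  ev0 (op_b lambda mu (mon R a S) (mon R b S')) = 0.
Proof.
move=> neS; rewrite ev0_op_b !ev0_mon !ev0_dx_mon big1 => [|i _].
  case: (eqVneq S set0) neS => [-> /negPf ->|_ _]; by rewrite /= !(mulr0, mul0r) !(subr0, addr0).
rewrite !ev0_eta_mon; case: (eqVneq S [set i]) neS => [-> /negPf ->|_ _].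
  by rewrite mulr0.
by rewrite mul0r.
Qed.

(** The common shape of [op_c], [op_d] and [op_e]. Its values on the complementary pairs of words in
    [i], [j] are [q], [r] and, up to sign, [p], so the parameters can be read off from [T]. *)
Definition op_x (p q r : R) i j F G : V :=
  p *: eta_wedge i j F G + q *: (F * eta j (eta i G)) + r *: (eta j (eta i F) * G).

Lemma op_cE mu i j F G : op_c mu i j F G = op_x 1 0 (2%:R * mu) i j F G.
Proof. by rewrite /op_x scale1r scale0r addr0. Qed.

Lemma op_dE lambda i j F G : op_d lambda i j F G = op_x 1 (2%:R * lambda) 0 i j F G.
Proof. by rewrite /op_x scale1r scale0r addr0. Qed.

Lemma op_eE lambda i j F G : i != j -> op_e lambda i j F G =
  op_x (lambda + 2%:R^-1) (- lambda) (- (lambda + 1)) i j F G.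
Proof.
move=> nij; rewrite /op_x /op_e !(eta_anti _ nij).
by rewrite mulrN mulNr !scaleNr !scalerN.
Qed.

Lemma bil_op_x p q r i j : bilinear_op (op_x p q r i j).
Proof.
apply: bil_add; first apply: bil_add.
- by apply/bil_scale/bil_add/bil_opp/bil_eta/bil_eta.
- by apply/bil_scale/(@bil_mul _ _ id (fun F => eta j (eta i F))) => //; exact/lin_eta/lin_eta/lin_id.
by apply/bil_scale/(@bil_mul _ _ (fun F => eta j (eta i F)) id) => //; exact/lin_eta/lin_eta/lin_id.
Qed.

Lemma transl_op_x p q r i j : translation_equivariant (op_x p q r i j).
Proof.
apply: transl_add; first apply: transl_add.
- exact/transl_scale/transl_eta_wedge.
- exact/transl_scale/transl_eta2r.
exact/transl_scale/transl_eta2l.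
Qed.

Lemma ev0_op_x p q r i j F G : ev0 (op_x p q r i j F G) =
  p * (ev0 (eta j F) * ev0 (eta i G) - ev0 (eta i F) * ev0 (eta j G))
  + q * (ev0 F * ev0 (eta j (eta i G))) + r * (ev0 (eta j (eta i F)) * ev0 G).
Proof.
have h k l : ev0 (eta k (psign F) * eta l G) = - (ev0 (eta k F) * ev0 (eta l G)).
  by rewrite ev0M ev0_eta_psign mulNr.
rewrite /op_x (ev0D (_ + _)) (ev0D (p *: _)) !ev0Z /eta_wedge (ev0D (_ * _)) ev0N.
congr (p * _ + q * _ + r * _); try exact: ev0M.
by apply: (etrans (congr2 (fun x y => x - y) (h i j) (h j i))); rewrite opprK addrC.
Qed.

Lemma ev0_op_x_mon p q r i j a b S S' : i != j ->
  ~~ [&& a == 0%N, b == 0%N, [disjoint S & S'] & S :|: S' == [set i; j]] ->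
  ev0 (op_x p q r i j (mon R a S) (mon R b S')) = 0.
Proof.
move=> nij h; have nji : j != i by rewrite eq_sym.
have dij : [disjoint [set i] & [set j]] by rewrite disjoints1 inE.
have h1 : ev0 (eta j (mon R a S)) * ev0 (eta i (mon R b S')) = 0.
  rewrite !ev0_eta_mon; case: andP => [[/eqP eS a0]|_]; last by rewrite mul0r.
  case: andP => [[/eqP eS' b0]|_]; last by rewrite mulr0.
  by case/negP: h; rewrite a0 b0 eS eS' disjoint_sym dij setUC eqxx.
have h2 : ev0 (eta i (mon R a S)) * ev0 (eta j (mon R b S')) = 0.
  rewrite !ev0_eta_mon; case: andP => [[/eqP eS a0]|_]; last by rewrite mul0r.
  case: andP => [[/eqP eS' b0]|_]; last by rewrite mulr0.
  by case/negP: h; rewrite a0 b0 eS eS' dij eqxx.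
have h3 : ev0 (mon R a S) * ev0 (eta j (eta i (mon R b S'))) = 0.
  rewrite ev0_mon; case: andP => [[/eqP eS a0]|_]; last by rewrite mul0r.
  rewrite ev0_eta2_mon ?mulr0 // -negb_and; apply: contra h => /andP[/eqP -> b0].
  by rewrite a0 b0 eS set0U eqxx -setI_eq0 set0I eqxx.
have h4 : ev0 (eta j (eta i (mon R a S))) * ev0 (mon R b S') = 0.
  rewrite [ev0 (mon R b S')]ev0_mon; case: andP => [[/eqP eS b0]|_]; last by rewrite mulr0.
  rewrite ev0_eta2_mon ?mul0r // -negb_and; apply: contra h => /andP[/eqP -> a0].
  by rewrite a0 b0 eS setU0 eqxx -setI_eq0 setI0 eqxx.
by rewrite ev0_op_x h1 h2 h3 h4 subrr !mulr0 !addr0.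
Qed.

Lemma eta_wmon0 i s : eta i (wmon R 0 s) = dtheta i (wmon R 0 s).
Proof. by rewrite /eta dx_wmon scale0r mulr0 subr0. Qed.

Lemma ev0_wmon0_nil : ev0 (wmon R (n := n) 0 [::]) = 1.
Proof. by rewrite wmon_nil /ev0 scoefE eqxx expr0 coef1. Qed.

Lemma ev0_wmon_cons a i s : ev0 (wmon R a (i :: s)) = 0.
Proof. by rewrite wmon_cons ev0M ev0_theta mul0r. Qed.

Section PairValues.
Variables (i j : 'I_n).
Hypothesis nij : i != j.
Variables (lambda mu p q r : R).

Let nji : j != i. Proof. by rewrite eq_sym. Qed.
Let eta_nil k : eta k (wmon R 0 [::]) = 0.
Proof. by rewrite eta_wmon0 dtheta_wmon. Qed.
Let eta0 k : eta k (0 : V) = 0.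
Proof. exact: (lin0 (lin_eta k (@lin_id R n))). Qed.
Let eta_self k : eta k (wmon R 0 [:: k]) = wmon R 0 [::].
Proof. by rewrite eta_wmon0 dtheta_wmon_head. Qed.
Let eta_other k l : k != l -> eta k (wmon R 0 [:: l]) = 0.
Proof. by move=> nkl; rewrite eta_wmon0 dtheta_wmon // inE. Qed.
Let eta_fst : eta i (wmon R 0 [:: i; j]) = wmon R 0 [:: j].
Proof. by rewrite eta_wmon0 dtheta_wmon_head // inE. Qed.
Local Notation X := (op_x p q r i j).
Local Notation w := (wmon R 0).

Lemma op_x_nil_pair : ev0 (X (w [::]) (w [:: i; j])) = q.
Proof.
by rewrite ev0_op_x !eta_nil eta0 eta_fst eta_self ev0_wmon0_nil ev00 !mul0r subrr; ring.
Qed.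
Lemma op_x_pair_nil : ev0 (X (w [:: i; j]) (w [::])) = r.
Proof.
by rewrite ev0_op_x !eta_nil eta0 eta_fst eta_self ev0_wmon0_nil ev00 !mulr0 subrr; ring.
Qed.
Lemma op_x_fst_snd : ev0 (X (w [:: i]) (w [:: j])) = - p.
Proof.
rewrite ev0_op_x !eta_self (eta_other nij) (eta_other nji) !eta0 ev0_wmon0_nil ev00 !ev0_wmon_cons.
ring.
Qed.
Lemma op_x_snd_fst : ev0 (X (w [:: j]) (w [:: i])) = p.
Proof.
rewrite ev0_op_x !eta_self (eta_other nij) (eta_other nji) !eta0 ev0_wmon0_nil ev00 !ev0_wmon_cons.
ring.
Qed.

End PairValues.

End Values.

(** * Comparison with the candidate operators *)

Section Classification.
Set Implicit Arguments.
Unset Strict Implicit.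
Variables (R : realFieldType) (n : nat) (lambda mu nu : R).
Local Notation V := (superpoly R n).
Variable T : V -> V -> V.
Hypothesis n_ge2 : (1 < n)%N.
Hypothesis bT : bilinear_op T.
Hypothesis iT : contact_invariant lambda mu nu T.
Implicit Types (F G H : V) (S : {set 'I_n}).

Let char0 m : m.+1%:R != 0 :> R. Proof. by rewrite pnatr_eq0. Qed.
Let i1 : 'I_n := Ordinal (ltnW n_ge2).
Let i2 : 'I_n := Ordinal n_ge2.
Let n12 : i1 != i2. Proof. by []. Qed.

Lemma phi_mon_support a S b S' : phi_mon T a S b S' != 0 ->
  (S' = S /\ (a + b + #|S| <= 1)%N) \/ [/\ n = 2, a = 0%N, b = 0%N & S' = ~: S].
Proof.
move=> h; have [eS|nS] := eqVneq S' S.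
  left; split=> //; rewrite leqNgt; apply: contra h => hs.
  by rewrite eS (phi_mon_diag bT iT).
have [eC|nC] := eqVneq S' (~: S); last by rewrite (phi_mon_rot bT iT) ?eqxx in h.
right; have : ~~ ((2 < n)%N || ((n == 2) && (0 < a + b)%N)).
  by apply: contra h => hn; rewrite eC (phi_mon_setC bT iT).
rewrite negb_or negb_and -leqNgt => /andP[le2 h2].
have e2 : n == 2 by rewrite eqn_leq le2.
by move: h2; rewrite e2 /= lt0n addn_eq0 negbK => /andP[/eqP -> /eqP ->]; split=> //; apply/eqP.
Qed.

Lemma weight_dichotomy : (exists F G, T F G <> 0) ->
  nu = lambda + mu \/ nu = lambda + mu + 1.
Proof.
move=> [F [G nz]].
have [h|h] := eqVneq nu (lambda + mu); first by left.
right; apply/eqP/negPn/negP => h1; apply: nz; move: F G.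
apply: (transl_eq0 char0 bT (invariant_transl char0 bT iT)) => a S b S'.
apply/eqP; rewrite -/(phi _ _ _) -/(phi_mon T a S b S'); apply/negPn/negP => hp.
have := phi_mon_weight bT iT hp.
have [[-> hs]|[e2 -> -> ->]] := phi_mon_support hp.
  have -> : (a.*2 + #|S| + (b.*2 + #|S|) = (a + b + #|S|) * 2)%N by lia.
  rewrite natrM; case: (a + b + #|S|)%N hs => [|[|//]] _ e.
    by case/eqP: h; lra.
  by case/eqP: h1; lra.
(* A complementary pair has total odd degree [n = 2], which gives the weight [lambda + mu + 1]. *)
rewrite add0n cardsC card_ord e2 => e; case/eqP: h1; lra.
Qed.

(** The weight equation leaves only the pair [(1, 1)], so the scalar is the value of [T] there. *)
Lemma degree0 : nu = lambda + mu ->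
  exists alpha : R, forall F G, T F G = alpha *: op_a F G.
Proof.
move=> hnu; exists (phi_mon T 0 set0 0 set0) => F G; apply: subr0_eq; rewrite -scaleNr.
move: F G; apply: (transl_eq0 char0).
- by apply/(bil_add bT)/bil_scale; exact: (@bil_mul _ _ id id).
- by apply/transl_add/transl_scale/transl_mulop; exact: (invariant_transl char0 bT iT).
move=> a S b S'; rewrite ev0D ev0Z /op_a ev0M !ev0_mon.
rewrite -/(phi _ _ _) -/(phi_mon T a S b S').
have [h0|hp] := eqVneq (phi_mon T a S b S') 0.
  rewrite h0 add0r; case: andP => [[/eqP eS /eqP ea]|_]; last by rewrite mul0r mulr0.
  case: andP => [[/eqP eS' /eqP eb]|_]; last by rewrite !mulr0.
  by rewrite eS ea eS' eb in h0; rewrite h0 oppr0 mul0r.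
have := phi_mon_weight bT iT hp.
rewrite hnu mulrDr natrD => e.
have /eqP : (a.*2 + #|S| + (b.*2 + #|S'|))%:R = 0 :> R by rewrite natrD; lra.
rewrite pnatr_eq0 !addn_eq0 !double_eq0 !cards_eq0.
move=> /andP[/andP[/eqP -> /eqP ->] /andP[/eqP -> /eqP ->]].
by rewrite !eqxx mul1r mulr1 subrr.
Qed.

Section Degree1.
Hypothesis hnu : nu = lambda + mu + 1.

Local Notation L := (2%:R * lambda).
Local Notation U := (2%:R * mu).
Local Notation C := (phi_mon T 0 [set i1] 0 [set i1]).

Lemma mon_set0 a : mon R a set0 = wmon R a [::] :> V.
Proof. by rewrite wmon_nil; apply/superpolyP => S; rewrite !scoefE. Qed.

Lemma mon_set1 a i : mon R a [set i] = wmon R a [:: i] :> V.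
Proof.
rewrite wmon_cons -mon_set0; apply/superpolyP => S; rewrite scoef_thetaM !scoef_mon.
rewrite setD_eq0 subset1; case: (boolP (i \in S)) => iS.
  case: eqP => [->|_] /=; first by rewrite nltE big_set1 ltnn mul1r.
  by case: eqP iS => [->|_ _]; rewrite ?inE // mulr0.
by case: eqP iS => // ->; rewrite set11.
Qed.

Lemma phi_mon_set1 i : phi_mon T 0 [set i] 0 [set i] = C.
Proof.
rewrite /phi_mon !mon_set1; have [->//|ni1] := eqVneq i i1.
exact: (Phi_rot_diag bT iT ni1).
Qed.

(** The factor [2 C] arises because [op_b] takes the value one half on [(theta_i, theta_i)], where
    [T] takes the value [C] for every [i] by rotation. If [a + b + #|S|] is not 1, both sides
    vanish. *)
Lemma phi_mon_diagE a b S : phi_mon T a S b S =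
  2%:R * C * ev0 (op_b lambda mu (mon R a S) (mon R b S)).
Proof.
rewrite ev0_op_b !ev0_mon !ev0_dx_mon.
under eq_bigr do rewrite !ev0_eta_mon.
have [e|ne] := eqVneq (a + b + #|S|)%N 1%N; last first.
  have -> : phi_mon T a S b S = 0.
    apply/eqP/negPn/negP => hp; have := phi_mon_weight bT iT hp.
    have [[_ hs]|[_ _ _ eS]] := phi_mon_support hp.
      have -> : (a.*2 + #|S| + (b.*2 + #|S|) = (a + b + #|S|) * 2)%N by lia.
      rewrite natrM hnu; case: (a + b + #|S|)%N hs ne => [|[|//]] _ //= _ h.
      by have /eqP : 1 = 0 :> R; [lra | rewrite oner_eq0].
    by have /setP/(_ i1) := eS; rewrite inE; case: (i1 \in S).
  rewrite big1 => [|i _].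
    case: (eqVneq S set0) ne => [->|_ _] /=; last by rewrite !(mul0r, mulr0, subr0, addr0).
    rewrite cards0 addn0.
    by case: a => [|[|a]]; case: b => [|[|b]] //= _; rewrite !(mul0r, mulr0, subr0, addr0).
  case: (eqVneq S [set i]) ne => [->|_ _]; last by rewrite mul0r.
  by rewrite cards1; case: a => [|a]; case: b => [|b] //= _; rewrite !(mul0r, mulr0).
have [eS|[i iS]] := set_0Vmem S.
  rewrite big1 => [|i _]; last first.
    rewrite eS; have /negPf -> : set0 != [set i] by rewrite eq_sym -card_gt0 cards1.
    by rewrite mul0r.
  move: e; rewrite eS cards0 addn0 eqxx /phi_mon !mon_set0 mon_set1.
  case: a => [|[|a]]; case: b => [|[|b]] //= _; rewrite ?addn0 // -!/(Phi _ _ _ _ _).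
    rewrite (Phi_diag0_right bT iT 0 0 i1); ring.
  rewrite (Phi_diag0_left bT iT 0 0 i1); ring.
have eS : S = [set i].
  by apply/eqP; rewrite eq_sym eqEcard sub1set iS cards1; lia.
have [-> ->] : a = 0%N /\ b = 0%N by move: e; rewrite eS cards1; lia.
rewrite eS (bigD1 i) //= big1 => [|j nji]; last first.
  rewrite (_ : ([set i] == [set j]) = false) ?mul0r //.
  by apply/negbTE; apply: contraNneq nji => /setP/(_ i); rewrite !inE eqxx => /esym/eqP ->.
have /negPf -> : [set i] != set0 by rewrite -card_gt0 cards1.
by rewrite !eqxx phi_mon_set1 /=; field.
Qed.

Lemma degree1_ge3 : (2 < n)%N ->
  exists alpha : R, forall F G, T F G = alpha *: op_b lambda mu F G.
Proof.
move=> n3; exists (2%:R * C) => F G; apply: subr0_eq; rewrite -scaleNr.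
move: F G; apply: (transl_eq0 char0).
- exact/(bil_add bT)/bil_scale/bil_op_b.
- by apply/transl_add/transl_scale/transl_op_b; exact: (invariant_transl char0 bT iT).
move=> a S b S'; rewrite ev0D ev0Z -/(phi _ _ _) -/(phi_mon T a S b S').
have [->|nS] := eqVneq S' S; first by rewrite phi_mon_diagE mulNr subrr.
rewrite ev0_op_b_neq // mulr0 addr0; apply/eqP/negPn/negP => hp.
have [[eS _]|[e2 _ _ _]] := phi_mon_support hp; first by rewrite eS eqxx in nS.
by rewrite e2 in n3.
Qed.

Local Notation D0 := (Phi T 0 [::] 0 [:: i1; i2]).
Local Notation D1 := (Phi T 0 [:: i1] 0 [:: i2]).
Local Notation D2 := (Phi T 0 [:: i1; i2] 0 [::]).

Lemma pair_equations : [/\ L * D1 + (1 + U) * D0 = 0, (1 + L) * D2 + U * D1 = 0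
  & L * D2 + U * D0 = 0].
Proof.
have := Phi_xtheta_notin bT iT 0 0 (isT : i1 \notin [::]) (isT : i1 \notin [:: i2]).
have := Phi_xtheta_notin bT iT 0 0 (isT : i2 \notin [:: i1]) (isT : i2 \notin [::]).
have := Phi_xrot_notin bT iT (isT : i1 \notin [::]) (isT : i2 \notin [::]) (isT : i1 \notin [::]) (isT : i2 \notin [::]) 0 0.
rewrite (Phi_swapl bT) /= expr0 expr1 => e2 e1 e0.
by split; lra.
Qed.

(** The hypotheses match [T] with [beta] times [op_x] on three complementary pairs; the fourth
    follows by rotation. Off these pairs [op_x] has value zero, so it does not disturb the diagonal
    values, which [op_b] accounts for. *)
Lemma degree1_pair p q r beta : n = 2 ->
  D0 = beta * q -> D1 = - (beta * p) -> D2 = beta * r ->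
  forall F G, T F G = 2%:R * C *: op_b lambda mu F G + beta *: op_x p q r i1 i2 F G.
Proof.
move=> e2 h0 h1 h2; pose T1 F G := T F G + (- beta) *: op_x p q r i1 i2 F G.
have bT1 : bilinear_op T1 by apply/(bil_add bT)/bil_scale/bil_op_x.
have tT1 : translation_equivariant T1.
  by apply/transl_add/transl_scale/transl_op_x; exact: (invariant_transl char0 bT iT).
have T1E F G : ev0 (T1 F G) = phi T F G - beta * ev0 (op_x p q r i1 i2 F G).
  by rewrite /T1 ev0D ev0Z mulNr.
have mem2 (x : 'I_n) : (x == i1) || (x == i2).
  by case: x => [[|[|x]] hx] //; exfalso; lia.
have hC S : phi_mon T1 0 S 0 (~: S) = 0.
  apply: (@phi_mon_words _ _ _ bT1 0 0 [seq x <- [:: i1; i2] | x \in S]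
    [seq x <- [:: i1; i2] | x \in ~: S]); rewrite ?filter_uniq //.
  - by move=> x; rewrite mem_filter !inE mem2 andbT.
  - by move=> x; rewrite mem_filter [x \in [:: _; _]]inE mem_seq1 mem2 andbT.
  rewrite /= !inE; case: (i1 \in S); case: (i2 \in S) => /=; rewrite /Phi [LHS]T1E -/(Phi _ _ _ _ _).
  - by rewrite op_x_pair_nil // h2 subrr.
  - by rewrite op_x_fst_snd // h1 mulrN opprK addNr.
  - rewrite op_x_snd_fst // (Phi_rot_cross bT iT n12) // h1 opprK subrr //.
  by rewrite op_x_nil_pair // h0 subrr.
move=> F G; apply: subr0_eq; rewrite opprD addrA addrAC -!scaleNr -/(T1 F G).
move: F G; apply: (transl_eq0 char0).
- exact/(bil_add bT1)/bil_scale/bil_op_b.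
- exact/(transl_add tT1)/transl_scale/transl_op_b.
move=> a S b S'; rewrite ev0D ev0Z.
have [->|nS] := eqVneq S' S.
  rewrite T1E -/(phi_mon T a S b S) phi_mon_diagE ev0_op_x_mon //; first by rewrite mulr0; ring.
  apply/negP => /and4P[_ _ dS]; rewrite setUid => /eqP eS; move: dS.
  by rewrite -setI_eq0 setIid eS => /eqP/setP/(_ i1); rewrite !inE eqxx.
rewrite ev0_op_b_neq // mulr0 addr0.
have [/and3P[/eqP -> /eqP -> /eqP ->]|hn] := boolP [&& a == 0%N, b == 0%N & S' == ~: S].
  exact: hC.
have h : phi_mon T a S b S' = 0.
  apply/eqP/negPn/negP => hp.
  have [[eS _]|[_ ea eb eS]] := phi_mon_support hp; first by rewrite eS eqxx in nS.
  by rewrite ea eb eS !eqxx in hn.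
rewrite T1E -/(phi_mon T a S b S') h ev0_op_x_mon ?mulr0 ?subr0 //.
apply: contra hn => /and4P[-> -> dS /eqP eS] /=; apply/eqP/setP => x; rewrite inE.
have := disjointFr dS (x := x); have /setP/(_ x) := eS; rewrite !inE mem2.
by case: (x \in S) => /=; [move=> _ -> | move=> ->].
Qed.

Lemma degree1_generic : n = 2 -> lambda * mu * nu != 0 ->
  exists alpha : R, forall F G, T F G = alpha *: op_b lambda mu F G.
Proof.
move=> e2; rewrite !mulf_eq0 !negb_or => /andP[/andP[l0 m0] n0].
have [e0 e1 e3] := pair_equations.
have d0 : D0 = 0.
  have : (U * (2%:R * nu)) * D0 = 0.
    (* Elimination of [D1] and [D2]; the coefficient left is [U (2 + L + U)], and [2 + L + U] is
       [2 nu]. *)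
    have -> : (U * (2%:R * nu)) * D0 = (1 + L) * (L * D2 + U * D0) - L * ((1 + L) * D2 + U * D1)
      + U * (L * D1 + (1 + U) * D0) by rewrite hnu; ring.
    by rewrite e0 e1 e3 !mulr0 subr0 addr0.
  by move/eqP; rewrite !mulf_eq0 (negPf m0) (negPf n0) pnatr_eq0 /= => /eqP.
have d1 : D1 = 0.
  by move/eqP: e0; rewrite d0 mulr0 addr0 !mulf_eq0 (negPf l0) pnatr_eq0 /= => /eqP.
have d2 : D2 = 0.
  by move/eqP: e3; rewrite d0 mulr0 addr0 !mulf_eq0 (negPf l0) pnatr_eq0 /= => /eqP.
exists (2%:R * C) => F G.
rewrite (@degree1_pair 0 0 0 0) ?mulr0 ?oppr0 //.
by rewrite scale0r addr0.
Qed.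

Lemma degree1_lambda0 : n = 2 -> lambda = 0 -> exists alpha beta : R, forall F G,
  T F G = alpha *: op_b lambda mu F G + beta *: op_c mu i1 i2 F G.
Proof.
move=> e2 l0; have [e0 e1 e3] := pair_equations; rewrite l0 in e0 e1 e3.
(* The system gives [D0 = 0] and [D2 = - U D1]. The wedge coefficient of [op_c] is 1, so matching
   [D1] forces [beta = - D1]. *)
exists (2%:R * C), (- D1) => F G; rewrite op_cE.
by apply: degree1_pair => //; lra.
Qed.

Lemma degree1_mu0 : n = 2 -> mu = 0 -> exists alpha beta : R, forall F G,
  T F G = alpha *: op_b lambda mu F G + beta *: op_d lambda i1 i2 F G.
Proof.
move=> e2 m0; have [e0 e1 e3] := pair_equations; rewrite m0 in e0 e1 e3.
exists (2%:R * C), (- D1) => F G; rewrite op_dE.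
by apply: degree1_pair => //; lra.
Qed.

Lemma degree1_nu0 : n = 2 -> nu = 0 -> exists alpha beta : R, forall F G,
  T F G = alpha *: op_b lambda mu F G + beta *: op_e lambda i1 i2 F G.
Proof.
move=> e2 nu0; have [e0 e1 e3] := pair_equations.
have eU : U = - 2%:R - L by move: nu0; rewrite hnu; lra.
(* For [nu = 0] the solutions are [(D0, D1, D2) = c (L, L + 1, L + 2)]. The factor [c = D2 - D1] is
   found without dividing by an entry that might vanish, and [op_e] takes the values [-1/2] times
   [(L, L + 1, L + 2)]. *)
rewrite eU in e0 e1 e3; exists (2%:R * C), (- 2%:R * (D2 - D1)) => F G; rewrite op_eE //.
by apply: degree1_pair => //; lra.
Qed.

End Degree1.
End Classification.

Theorem theorem3p1 (R : realType) (n : nat) (n_ge2 : (1 < n)%N)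
    (lambda mu nu : R) (T : superpoly R n -> superpoly R n -> superpoly R n)
    (T_bidiff : is_bidiff T)
    (T_invariant : contact_invariant lambda mu nu T)
    (T_nonzero : exists F G, T F G <> 0) :
  let i1 : 'I_n := Ordinal (ltnW n_ge2) in
  let i2 : 'I_n := Ordinal n_ge2 in
  [/\ nu = lambda + mu \/ nu = lambda + mu + 1,
      nu = lambda + mu ->
        exists alpha : R, forall F G, T F G = alpha *: op_a F G
    & nu = lambda + mu + 1 ->
        ((2 < n)%N \/ n = 2%N /\ lambda * mu * nu <> 0 ->
           exists alpha : R, forall F G, T F G = alpha *: op_b lambda mu F G)
        /\
        (n = 2%N ->
           [/\ lambda = 0 -> exists alpha beta : R, forall F G,
                 T F G = alpha *: op_b lambda mu F G
                         + beta *: op_c mu i1 i2 F G,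
               mu = 0 -> exists alpha beta : R, forall F G,
                 T F G = alpha *: op_b lambda mu F G
                         + beta *: op_d lambda i1 i2 F G
             & nu = 0 -> exists alpha beta : R, forall F G,
                 T F G = alpha *: op_b lambda mu F G
                         + beta *: op_e lambda i1 i2 F G])].
Proof.
have bT := bidiff_bilinear T_bidiff.
split=> [|hnu|hnu].
- exact: (weight_dichotomy n_ge2 bT T_invariant T_nonzero).
- exact: (degree0 bT T_invariant hnu).
split=> [[n3|[e2 /eqP nz]]|e2].
- exact: (degree1_ge3 n_ge2 bT T_invariant hnu n3).
- exact: (degree1_generic n_ge2 bT T_invariant hnu e2 nz).
split.
- exact: (degree1_lambda0 n_ge2 bT T_invariant hnu e2).
- exact: (degree1_mu0 n_ge2 bT T_invariant hnu e2).
exact: (degree1_nu0 n_ge2 bT T_invariant hnu e2).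
Qed.
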